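(* Let $i\in\mathbb{N}_0$ and let $\alpha,\beta,\gamma\in\mathbb{C}$. Then $$F^{2:0;1}_{1:0;1}\left[\begin{matrix}\alpha,\ \gamma: & -\,; & \alpha-\beta-\gamma+1+i\,;\\ \beta: & -\,; & \alpha-\gamma+1+i\,;\end{matrix}\ -1,\ 1\right] =\frac{2^{i-2\gamma}\,\Gamma(1+\alpha-\gamma+i)\,\Gamma(\gamma-i)}{\Gamma(\gamma)\,\Gamma(1+\alpha-2\gamma+i)}\sum_{r=0}^{i}(-1)^r\binom{i}{r}\frac{\Gamma\!\left(\frac{\alpha+i+r+1}{2}-\gamma\right)}{\Gamma\!\left(\frac{\alpha-i+r+1}{2}\right)}$$ and $$F^{2:0;1}_{1:0;1}\left[\begin{matrix}\alpha,\ \gamma: & -\,; & \alpha-\beta-\gamma+1-i\,;\\ \beta: & -\,; & \alpha-\gamma+1-i\,;\end{matrix}\ -1,\ 1\right] =\frac{2^{-i-2\gamma}\,\Gamma(1+\alpha-\gamma-i)}{\Gamma(1+\alpha-2\gamma-i)}\sum_{r=0}^{i}\binom{i}{r}\frac{\Gamma\!\left(\frac{\alpha-i+r+1}{2}-\gamma\right)}{\Gamma\!\left(\frac{\alpha-i+r+1}{2}\right)}.$$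
   Context: For $\lambda\in\mathbb{C}$ and $n\in\mathbb{N}_0$, $(\lambda)_0=1$ and $(\lambda)_n=\lambda(\lambda+1)\cdots(\lambda+n-1)$; $\Gamma$ is Euler's Gamma function and $\binom{i}{r}$ the binomial coefficient. The (generalized) Kampé de Fériet function is defined by $$F^{H:A;B}_{G:C;D}\left[\begin{matrix}(h_H): & (a_A)\,; & (b_B)\,;\\ (g_G): & (c_C)\,; & (d_D)\,;\end{matrix}\ x,\ y\right]=\sum_{m=0}^\infty\sum_{n=0}^\infty\frac{\prod_{j=1}^H(h_j)_{m+n}\prod_{j=1}^A(a_j)_m\prod_{j=1}^B(b_j)_n}{\prod_{j=1}^G(g_j)_{m+n}\prod_{j=1}^C(c_j)_m\prod_{j=1}^D(d_j)_n}\frac{x^m}{m!}\frac{y^n}{n!},$$ where a dash ''$-$'' denotes an empty list of parameters (empty products equal $1$). Parameters are tacitly assumed to be such that the double series converges, no denominator parameter is a non-positive integer, and all Gamma values appearing are finite. *)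

(* Defs.v *)
From Stdlib Require Import Reals.
From Coquelicot Require Export Coquelicot.

Open Scope C_scope.

Fixpoint csum (f : nat -> C) (n : nat) : C :=
  match n with
  | O => 0
  | S n' => csum f n' + f n'
  end.

Fixpoint cprod (f : nat -> C) (n : nat) : C :=
  match n with
  | O => 1
  | S n' => cprod f n' * f n'
  end.

Definition poch (a : C) (n : nat) : C := cprod (fun k => a + RtoC (INR k)) n.

(* complex power x^z = exp(z ln x) for a real x > 0 (principal branch) *)
Definition cpow_pos (x : R) (z : C) : C :=
  (exp (Re z * ln x) * cos (Im z * ln x),
   exp (Re z * ln x) * sin (Im z * ln x))%R.

Definition nonpos_int (z : C) : Prop := exists k : nat, z = - RtoC (INR k).

(* Euler's Gamma function on C, via the Euler-Gauss limit
   Gamma(z) = lim_{n->oo} n! n^z / (z (z+1) ... (z+n)),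
   valid for every z that is not a non-positive integer. *)
Definition Gauss_seq (z : C) (n : nat) : C :=
  RtoC (INR (Factorial.fact n)) * cpow_pos (INR n) z / cprod (fun k => z + RtoC (INR k)) (S n).

Definition CGamma (z : C) : C :=
  @lim C_CompleteNormedModule (filtermap (Gauss_seq z) eventually).

(* the general term of
   F^{2:0;1}_{1:0;1}[ h1, h2 : - ; b ; g : - ; d ; x, y ] *)
Definition KdF_term (h1 h2 g b d x y : C) (m n : nat) : C :=
  poch h1 (m + n) * poch h2 (m + n) * poch b n
  / (poch g (m + n) * poch d n)
  * (Cpow x m / RtoC (INR (Factorial.fact m))) * (Cpow y n / RtoC (INR (Factorial.fact n))).

Definition KdF_partial (h1 h2 g b d x y : C) (K : nat) : C :=
  csum (fun N => csum (fun m => KdF_term h1 h2 g b d x y m (N - m)) (S N)) (S K).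

Definition KdF_converges_to (h1 h2 g b d x y L : C) : Prop :=
  filterlim (KdF_partial h1 h2 g b d x y) eventually (locally L).

Definition KdF_converges (h1 h2 g b d x y : C) : Prop :=
  exists L, KdF_converges_to h1 h2 g b d x y L.

Definition cbinom (n r : nat) : C := RtoC (Binomial.C n r).

(* Main.v *)
Require Import Defs.
From Stdlib Require Import Reals Lra Lia Factorial.
From Coquelicot Require Import Coquelicot.
Open Scope C_scope.

(* Summing along the diagonals m + n = N, Chu-Vandermonde collapses the inner sum and cancels beta: the double
   series is 2F1(alpha, gamma; d; -1) with d = 1 + alpha - gamma + i or 1 + alpha - gamma - i.  After division by
   Gamma(d) everything is entire in the parameters.  Contiguous relations, in the form of telescoping identities for
   partial sums, turn Pascal's rule for the finite sums on the right-hand side into a reduction to i = 0, which is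
   Kummer's theorem.  The only convergence information needed throughout is that the terms tend to 0.

   For Kummer's theorem, the shift b -> b - 1 reduces to Re b <= -1, where the series converges absolutely.  The
   shift a -> a + 2 then shows that sum and closed form satisfy the same recurrence, and as n -> oo the unregularised
   sum at a + 2 n has a limit that does not depend on a (dominated convergence), so it suffices to compare with
   a = 0, where the sum has a single term. *)

(** * Convergence of complex sequences *)

(** The hypotheses provide only convergence of the diagonal partial sums, possibly conditional, at
    arbitrary complex parameters. Analytic continuation from the region of absolute convergence
    would require control up to its boundary. Exact identities between partial sums replace it:
    outside absolute convergence, each one leaves a boundary term that is a combination of series
    terms with coefficients bounded in the index, so it vanishes in the limit. The inductions pass
    through parameters where factors such as [c - g] vanish or the unregularised series has a pole.
    With [1 / Gamma] in place of [Gamma] no case distinction arises, and taking it from the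
    reciprocals of the Gauss quotients that define [CGamma] makes the link to the statement a mere
    inversion. In the first identity put [g = gamma - i]. Then [d = 1 + alpha - g] is well-poised
    for [g], and the defect [i] sits in the upper parameter [gamma = g + i]; in the second it sits
    in [d]. Hence two contiguous relations and two inductions. The threshold [Re b <= -1] is where
    [(b)_n / n!], of order [n^(b-1)], becomes [O(1/n^2)]. *)

Definition Ccv (u : nat -> C) (l : C) : Prop :=
  is_lim_seq (fun n => Re (u n)) (Re l) /\ is_lim_seq (fun n => Im (u n)) (Im l).

Lemma C_ext (x y : C) : Re x = Re y -> Im x = Im y -> x = y.
Proof. destruct x, y; simpl; congruence. Qed.

Lemma Cmod_le_Re_Im (z : C) : (Cmod z <= Rabs (Re z) + Rabs (Im z))%R.
Proof.
  unfold Cmod; fold (Re z) (Im z).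
  rewrite <- (sqrt_Rsqr (Rabs (Re z) + Rabs (Im z))%R)
    by (generalize (Rabs_pos (Re z)) (Rabs_pos (Im z)); lra).
  apply sqrt_le_1_alt. unfold Rsqr.
  generalize (Rabs_pos (Re z)) (Rabs_pos (Im z)) (pow2_abs (Re z)) (pow2_abs (Im z)).
  intros; unfold Re, Im in *; nra.
Qed.

Lemma Im_le_Cmod (z : C) : (Rabs (Im z) <= Cmod z)%R.
Proof. eapply Rle_trans; [ apply Rmax_r | apply Rmax_Cmod ]. Qed.

Lemma Ccv_Cmod (u : nat -> C) (l : C) :
  Ccv u l <-> is_lim_seq (fun n => Cmod (u n - l)) 0%R.
Proof.
  split.
  - intros [H1 H2].
    apply (is_lim_seq_le_le (fun _ => 0%R) _
      (fun n => Rabs (Re (u n) - Re l) + Rabs (Im (u n) - Im l))%R).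
    + intros n; split; [ apply Cmod_ge_0 | ].
      exact (Cmod_le_Re_Im (u n - l)).
    + apply is_lim_seq_const.
    + replace 0%R with (Rabs (Re l - Re l) + Rabs (Im l - Im l))%R
        by (rewrite !Rminus_diag, Rabs_R0; ring).
      apply is_lim_seq_plus';
        apply (is_lim_seq_abs _ (Finite _)); apply is_lim_seq_minus'; auto;
        apply is_lim_seq_const.
  - intros H; split.
    + apply (is_lim_seq_ext (fun n => (Re (u n) - Re l) + Re l)%R); [ intros; ring | ].
      replace (Finite (Re l)) with (Finite (0 + Re l)) by (f_equal; ring).
      apply is_lim_seq_plus'; [ | apply is_lim_seq_const ].
      apply is_lim_seq_abs_0.
      apply (is_lim_seq_le_le (fun _ => 0%R) _ (fun n => Cmod (u n - l))); auto;
        [ | apply is_lim_seq_const ].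
      intros n; split; [ apply Rabs_pos | exact (re_le_Cmod (u n - l)) ].
    + apply (is_lim_seq_ext (fun n => (Im (u n) - Im l) + Im l)%R); [ intros; ring | ].
      replace (Finite (Im l)) with (Finite (0 + Im l)) by (f_equal; ring).
      apply is_lim_seq_plus'; [ | apply is_lim_seq_const ].
      apply is_lim_seq_abs_0.
      apply (is_lim_seq_le_le (fun _ => 0%R) _ (fun n => Cmod (u n - l))); auto;
        [ | apply is_lim_seq_const ].
      intros n; split; [ apply Rabs_pos | exact (Im_le_Cmod (u n - l)) ].
Qed.

Lemma Ccv_const (c : C) : Ccv (fun _ => c) c.
Proof. split; apply is_lim_seq_const. Qed.

Lemma Ccv_plus u v l m : Ccv u l -> Ccv v m -> Ccv (fun n => u n + v n) (l + m).
Proof. intros [] []; split; simpl; apply is_lim_seq_plus'; auto. Qed.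

Lemma Ccv_minus u v l m : Ccv u l -> Ccv v m -> Ccv (fun n => u n - v n) (l - m).
Proof. intros [] []; split; simpl; apply is_lim_seq_minus'; auto. Qed.

Lemma Ccv_mult u v l m : Ccv u l -> Ccv v m -> Ccv (fun n => u n * v n) (l * m).
Proof.
  intros [] []; split; simpl;
    [ apply is_lim_seq_minus' | apply is_lim_seq_plus' ]; apply is_lim_seq_mult'; auto.
Qed.

Lemma Ccv_scal c u l : Ccv u l -> Ccv (fun n => c * u n) (c * l).
Proof. intros; apply Ccv_mult; auto using Ccv_const. Qed.

Lemma Ccv_inv (u : nat -> C) (l : C) : l <> 0 -> Ccv u l -> Ccv (fun n => / u n) (/ l).
Proof.
  intros Hl [H1 H2].
  assert (Hd : (Re l ^ 2 + Im l ^ 2)%R <> 0%R).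
  { rewrite <- Cmod2_alt. apply pow_nonzero. intros H; apply Hl, Cmod_eq_0, H. }
  assert (H : is_lim_seq (fun n => (Re (u n) ^ 2 + Im (u n) ^ 2)%R) (Re l ^ 2 + Im l ^ 2)%R).
  { apply (is_lim_seq_ext (fun n => (Re (u n) * Re (u n) + Im (u n) * Im (u n))%R));
      [ intros; ring | ].
    replace (Re l ^ 2 + Im l ^ 2)%R with (Re l * Re l + Im l * Im l)%R by ring.
    apply is_lim_seq_plus'; apply is_lim_seq_mult'; auto. }
  split.
  - exact (is_lim_seq_div' _ _ _ _ H1 H Hd).
  - exact (is_lim_seq_div' _ _ _ _ (proj1 (is_lim_seq_opp _ _) H2) H Hd).
Qed.

Lemma Ccv_div (u v : nat -> C) (l m : C) : m <> 0 -> Ccv u l -> Ccv v m -> Ccv (fun n => u n / v n) (l / m).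
Proof. intros; apply Ccv_mult; auto using Ccv_inv. Qed.

Lemma Ccv_unique u l m : Ccv u l -> Ccv u m -> l = m.
Proof.
  intros [A1 A2] [B1 B2]; apply C_ext.
  - apply is_lim_seq_unique in A1; apply is_lim_seq_unique in B1.
    rewrite A1 in B1; now inversion B1.
  - apply is_lim_seq_unique in A2; apply is_lim_seq_unique in B2.
    rewrite A2 in B2; now inversion B2.
Qed.

Lemma Ccv_ext_loc u v l :
  eventually (fun n => u n = v n) -> Ccv u l -> Ccv v l.
Proof.
  intros [N HN] [A B]; split.
  - apply (is_lim_seq_ext_loc (fun n => Re (u n))); auto.
    exists N; intros n Hn; now rewrite HN.
  - apply (is_lim_seq_ext_loc (fun n => Im (u n))); auto.
    exists N; intros n Hn; now rewrite HN.
Qed.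

Lemma Ccv_ext u v l : (forall n, u n = v n) -> Ccv u l -> Ccv v l.
Proof. intros H; apply Ccv_ext_loc; exists O; auto. Qed.

Lemma Ccv_eq u l m : Ccv u l -> l = m -> Ccv u m.
Proof. now intros H <-. Qed.

Lemma Ccv_incr u l : Ccv u l <-> Ccv (fun n => u (S n)) l.
Proof.
  unfold Ccv. rewrite (is_lim_seq_incr_1 (fun n => Re (u n))),
    (is_lim_seq_incr_1 (fun n => Im (u n))). tauto.
Qed.

Lemma Ccv_subseq u l phi :
  filterlim phi eventually eventually -> Ccv u l -> Ccv (fun n => u (phi n)) l.
Proof.
  intros Hp [A B]; split.
  - apply (is_lim_seq_subseq (fun n => Re (u n))); auto.
  - apply (is_lim_seq_subseq (fun n => Im (u n))); auto.
Qed.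

(** Bridge to the filter limits behind [KdF_converges_to] and [CGamma]. Inside the proof limits are
    taken componentwise, so that the arithmetic of real sequences applies. *)
Lemma Ccv_filterlim u l : Ccv u l <-> filterlim u eventually (locally l).
Proof.
  split.
  - intros [A B]. apply filterlim_locally; intros eps.
    apply is_lim_seq_spec in A; apply is_lim_seq_spec in B.
    destruct (A eps) as [N1 H1]; destruct (B eps) as [N2 H2].
    exists (N1 + N2)%nat; intros n Hn; split; [ apply H1 | apply H2 ]; lia.
  - intros H. split; apply is_lim_seq_spec; intros eps;
    destruct (proj1 (filterlim_locally u l) H eps) as [N HN]; exists N; intros n Hn;
    apply HN; auto.
Qed.

Lemma Ccv_0_bound u v :
  eventually (fun n => (Cmod (u n) <= v n)%R) -> is_lim_seq v 0%R -> Ccv u 0.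
Proof.
  intros Hb Hv. apply Ccv_Cmod.
  apply (is_lim_seq_le_le_loc (fun _ => 0%R) _ v); auto; [ | apply is_lim_seq_const ].
  destruct Hb as [N HN]; exists N; intros n Hn; split; [ apply Cmod_ge_0 | ].
  replace (u n - 0) with (u n) by ring; auto.
Qed.

Lemma Ccv_Cmod_lim u l : Ccv u l -> is_lim_seq (fun n => Cmod (u n)) (Cmod l).
Proof.
  intros [A B].
  apply (is_lim_seq_ext (fun n => sqrt (Re (u n) * Re (u n) + Im (u n) * Im (u n))%R)).
  { intros n; unfold Cmod, Re, Im; f_equal; ring. }
  replace (Cmod l) with (sqrt (Re l * Re l + Im l * Im l)%R)
    by (unfold Cmod, Re, Im; f_equal; ring).
  apply is_lim_seq_continuous; [ apply continuity_pt_sqrt; nra | ].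
  apply is_lim_seq_plus'; apply is_lim_seq_mult'; auto.
Qed.

Lemma Ccv_nonzero_eventually (u : nat -> C) (l : C) : l <> 0 -> Ccv u l -> eventually (fun n => u n <> 0).
Proof.
  intros Hl H. apply Ccv_Cmod_lim, is_lim_seq_spec in H.
  apply Cmod_gt_0 in Hl. destruct (H (mkposreal _ Hl)) as [N HN].
  exists N; intros n Hn E; specialize (HN n Hn); simpl in HN.
  rewrite E, Cmod_0 in HN. rewrite Rminus_0_l, Rabs_Ropp, Rabs_pos_eq in HN; [ lra | apply Cmod_ge_0 ].
Qed.

Lemma bounded_of_eventually (u : nat -> C) (B : R) :
  eventually (fun n => (Cmod (u n) <= B)%R) ->
  exists B', (0 <= B')%R /\ forall n, (Cmod (u n) <= B')%R.
Proof.
  intros [N HN].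
  assert (HB : forall M, exists B, (0 <= B)%R /\ forall n, (n < M)%nat -> (Cmod (u n) <= B)%R).
  { induction M as [ | M [B' [HB0 HB]] ].
    - exists 0%R; split; [ lra | intros; lia ].
    - exists (B' + Cmod (u M))%R; split; [ generalize (Cmod_ge_0 (u M)); lra | ].
      intros n Hn. generalize (Cmod_ge_0 (u M)).
      destruct (Nat.eq_dec n M) as [-> | E]; [ lra | ].
      specialize (HB n ltac:(lia)); lra. }
  destruct (HB N) as [B' [HB0 HB']].
  exists (B' + Rabs B)%R; split; [ generalize (Rabs_pos B); lra | ].
  intros n. generalize (Rabs_pos B) (Rle_abs B).
  destruct (Nat.lt_ge_cases n N) as [h | h];
    [ specialize (HB' n h) | specialize (HN n h) ]; lra.
Qed.

Lemma Ccv_bounded u l : Ccv u l -> exists B, (0 <= B)%R /\ forall n, (Cmod (u n) <= B)%R.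
Proof.
  intros H. apply (bounded_of_eventually u (Cmod l + 1)).
  apply Ccv_Cmod_lim, is_lim_seq_spec in H. destruct (H (mkposreal 1 Rlt_0_1)) as [N HN].
  exists N; intros n Hn; specialize (HN n Hn); simpl in HN. apply Rabs_def2 in HN. lra.
Qed.

Lemma is_lim_seq_inv_S : is_lim_seq (fun n => (/ INR (S n))%R) 0%R.
Proof.
  apply (is_lim_seq_incr_1 (fun n => (/ INR n)%R)).
  replace (Finite 0) with (Rbar_inv p_infty) by reflexivity.
  apply is_lim_seq_inv; [ apply is_lim_seq_INR | discriminate ].
Qed.

Lemma Cmod_lim_le u l B : Ccv u l -> eventually (fun n => (Cmod (u n) <= B)%R) -> (Cmod l <= B)%R.
Proof.
  intros H Hb.
  assert (X := is_lim_seq_le_loc _ (fun _ => B) _ (Finite B) Hb (Ccv_Cmod_lim _ _ H) (is_lim_seq_const B)).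
  exact X.
Qed.

(** The majorant [1 / ((n+1)(n+2))] is written as a difference so that its sums collapse. It serves
    as the single comparison series, both for the Gauss products and for the hypergeometric sums. *)
Lemma telescoping_dist (q : nat -> C) (D : R) :
  (forall n, (Cmod (q (S n) - q n) <= D * (/ INR (S n) - / INR (S (S n))))%R) ->
  forall n k, (Cmod (q (n + k)%nat - q n) <= D * (/ INR (S n) - / INR (S (n + k))))%R.
Proof.
  intros H n; induction k as [ | k IH ].
  - rewrite Nat.add_0_r. replace (q n - q n) with (RtoC 0) by ring.
    rewrite Cmod_0; lra.
  - rewrite Nat.add_succ_r.
    replace (q (S (n + k)) - q n) with ((q (S (n + k)) - q (n + k)%nat) + (q (n + k)%nat - q n)) by ring.
    eapply Rle_trans; [ apply Cmod_triangle | ].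
    specialize (H (n + k)%nat). lra.
Qed.

(** The tail bound depends on [q] only through [D]; this uniformity is what later permits the
    exchange of limits. *)
Lemma telescoping_cv (q : nat -> C) (D : R) :
  (0 <= D)%R ->
  (forall n, (Cmod (q (S n) - q n) <= D * (/ INR (S n) - / INR (S (S n))))%R) ->
  exists l, Ccv q l /\ forall n, (Cmod (l - q n) <= D * / INR (S n))%R.
Proof.
  intros HD H.
  assert (HB : forall n k, (Cmod (q (n + k)%nat - q n) <= D * / INR (S n))%R).
  { intros n k. eapply Rle_trans; [ apply telescoping_dist, H | ].
    apply Rmult_le_compat_l; auto.
    assert (0 < / INR (S (n + k)))%R by (apply Rinv_0_lt_compat, lt_0_INR; lia). lra. }
  assert (HD0 : is_lim_seq (fun n => (D * / INR (S n))%R) 0%R).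
  { replace (Finite 0) with (Finite (D * 0)) by (f_equal; ring).
    apply is_lim_seq_mult'; [ apply is_lim_seq_const | apply is_lim_seq_inv_S ]. }
  (* [f] stands for [Re] and for [Im], so that the Cauchy argument is made once. *)
  assert (HC : forall f : C -> R, (forall x y : C, f (Cminus x y) = (f x - f y)%R) ->
     (forall x : C, (Rabs (f x) <= Cmod x)%R) -> ex_finite_lim_seq (fun n => f (q n))).
  { intros f Hf1 Hf2. apply ex_lim_seq_cauchy_corr. intros eps.
    apply is_lim_seq_spec in HD0.
    destruct (HD0 (mkposreal (eps / 2) ltac:(generalize (cond_pos eps); lra))) as [N HN].
    exists N. intros n m Hn Hm.
    assert (HX : forall n, (N <= n)%nat -> (Rabs (f (q n) - f (q N)) < eps / 2)%R).
    { intros p Hp. rewrite <- Hf1. eapply Rle_lt_trans; [ apply Hf2 | ].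
      replace p with (N + (p - N))%nat by lia.
      eapply Rle_lt_trans; [ apply HB | ].
      specialize (HN N (Nat.le_refl N)); simpl in HN.
      rewrite Rminus_0_r in HN. eapply Rle_lt_trans; [ apply Rle_abs | exact HN ]. }
    replace (f (q n) - f (q m))%R with ((f (q n) - f (q N)) - (f (q m) - f (q N)))%R by ring.
    eapply Rle_lt_trans; [ apply Rabs_triang | ].
    rewrite Rabs_Ropp. generalize (HX n Hn) (HX m Hm); lra. }
  destruct (HC Re) as [x Hx]; [ reflexivity | apply re_le_Cmod | ].
  destruct (HC Im) as [y Hy]; [ reflexivity | apply Im_le_Cmod | ].
  exists (x, y).
  assert (Hl : Ccv q (x, y)) by (split; assumption).
  split; auto. intros n.
  apply (Cmod_lim_le (fun m => q m - q n)).
  - apply Ccv_minus; auto using Ccv_const.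
  - exists n; intros m Hm. replace m with (n + (m - n))%nat by lia. apply HB.
Qed.

(** The step [p] is 1 for running indices and 2 for the shift [a + 2 n] in Kummer's theorem. *)
Lemma Ccv_affine_infty (c : C) (p : nat) :
  (0 < p)%nat -> Ccv (fun n => / (c + RtoC (INR (p * n)))) 0.
Proof.
  intros Hp.
  assert (HL : is_lim_seq (fun n => (INR n - Cmod c)%R) p_infty).
  { apply (is_lim_seq_minus _ _ p_infty (Finite (Cmod c)));
      [ apply is_lim_seq_INR | apply is_lim_seq_const | reflexivity ]. }
  apply (Ccv_0_bound _ (fun n => / (INR n - Cmod c))%R).
  - apply is_lim_seq_spec in HL. destruct (HL 0%R) as [N HN].
    exists N; intros n Hn; specialize (HN n Hn).
    assert (Hm : (INR n - Cmod c <= Cmod (c + RtoC (INR (p * n))))%R).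
    { assert (H1 := Cmod_triangle (c + RtoC (INR (p * n))) (- c)).
      replace (c + INR (p * n) + - c) with (RtoC (INR (p * n))) in H1 by ring.
      rewrite Cmod_opp, Cmod_R, Rabs_pos_eq in H1 by apply pos_INR.
      assert (INR n <= INR (p * n))%R by (apply le_INR; nia). lra. }
    rewrite Cmod_inv.
    + apply Rinv_le_contravar; auto.
    + apply Cmod_gt_0; lra.
  - replace (Finite 0) with (Rbar_inv p_infty) by reflexivity.
    apply is_lim_seq_inv; [ exact HL | discriminate ].
Qed.

Lemma affine_eventually_nonzero (c : C) (p : nat) :
  (0 < p)%nat -> eventually (fun n => c + RtoC (INR (p * n)) <> 0).
Proof.
  intros Hp. destruct (INR_unbounded (Cmod c)) as [N HN]. exists N; intros n Hn E.
  assert (H1 : RtoC (INR (p * n)) = (c + RtoC (INR (p * n))) - c) by ring.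
  rewrite E in H1. replace (0 - c) with (- c) in H1 by ring.
  apply (f_equal Cmod) in H1.
  rewrite Cmod_opp, Cmod_R, Rabs_pos_eq in H1 by apply pos_INR.
  assert (INR N <= INR (p * n))%R by (apply le_INR; nia). lra.
Qed.

Lemma Ccv_ratio_affine (c d : C) (p : nat) :
  (0 < p)%nat -> Ccv (fun n => (c + RtoC (INR (p * n))) / (d + RtoC (INR (p * n)))) 1.
Proof.
  intros Hp.
  apply (Ccv_ext_loc (fun n => 1 + (c - d) * / (d + RtoC (INR (p * n))))).
  - destruct (affine_eventually_nonzero d p Hp) as [N HN].
    exists N; intros n Hn. specialize (HN n Hn). now field.
  - apply (Ccv_eq _ (1 + (c - d) * 0)); [ | ring ].
    apply Ccv_plus; [ apply Ccv_const | apply Ccv_scal, Ccv_affine_infty, Hp ].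
Qed.

(** A total function: without convergence its value carries no meaning, so it is read through
    [Clim_unique] or [Clim_cv]. *)
Definition Clim (u : nat -> C) : C :=
  (real (Lim_seq (fun n => Re (u n))), real (Lim_seq (fun n => Im (u n)))).

Lemma Clim_unique (u : nat -> C) (l : C) : Ccv u l -> Clim u = l.
Proof.
  intros [H1 H2]. apply C_ext.
  - exact (f_equal real (is_lim_seq_unique _ _ H1)).
  - exact (f_equal real (is_lim_seq_unique _ _ H2)).
Qed.

Lemma Clim_cv (u : nat -> C) : (exists l, Ccv u l) -> Ccv u (Clim u).
Proof. intros [l H]. now rewrite (Clim_unique _ _ H). Qed.

(** Passes null terms from one series to a contiguous one. The relation is multiplied out because
    [x + n] may vanish at one index, which does not affect the limit. *)
Lemma Ccv_0_affine (u v : nat -> C) (x k : C) :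
  Ccv u 0 -> (forall n, (x + RtoC (INR n)) * v n = k * u n) -> Ccv v 0.
Proof.
  intros Hu H.
  apply (Ccv_ext_loc (fun n => / (x + RtoC (INR (1 * n))) * (k * u n))).
  - destruct (affine_eventually_nonzero x 1 Nat.lt_0_1) as [N HN].
    exists N; intros n Hn. specialize (HN n Hn). rewrite Nat.mul_1_l in *.
    rewrite <- H. now field.
  - apply (Ccv_eq _ (0 * (k * 0))); [ | ring ].
    apply Ccv_mult; [ apply Ccv_affine_infty; lia | now apply Ccv_scal ].
Qed.

Lemma Ccv_0_affine_ratio (u v : nat -> C) (x y k : C) :
  Ccv u 0 ->
  (forall n, (x + RtoC (INR n)) * v n = k * ((y + RtoC (INR n)) * u n)) -> Ccv v 0.
Proof.
  intros Hu H.
  apply (Ccv_ext_loc (fun n => (y + RtoC (INR (1 * n))) / (x + RtoC (INR (1 * n))) * (k * u n))).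
  - destruct (affine_eventually_nonzero x 1 Nat.lt_0_1) as [N HN].
    exists N; intros n Hn. specialize (HN n Hn). rewrite Nat.mul_1_l in *.
    replace (v n) with ((x + RtoC (INR n)) * v n / (x + RtoC (INR n))) by now field.
    rewrite H. now field.
  - apply (Ccv_eq _ (1 * (k * 0))); [ | ring ].
    apply Ccv_mult; [ apply Ccv_ratio_affine; lia | now apply Ccv_scal ].
Qed.

(** * Complex powers and infinite products *)

Lemma cpow_pos_plus (x : R) (z w : C) : cpow_pos x (z + w) = cpow_pos x z * cpow_pos x w.
Proof.
  destruct z as [a b], w as [c d]; unfold cpow_pos; simpl.
  rewrite !Rmult_plus_distr_r, exp_plus, cos_plus, sin_plus.
  apply C_ext; simpl; ring.
Qed.

Lemma cpow_pos_0 (x : R) : cpow_pos x 0 = 1.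
Proof. unfold cpow_pos; simpl. rewrite !Rmult_0_l, exp_0, cos_0, sin_0. apply C_ext; simpl; ring. Qed.

Lemma cpow_pos_1 (x : R) : (0 < x)%R -> cpow_pos x 1 = RtoC x.
Proof.
  intros H; unfold cpow_pos; simpl.
  rewrite Rmult_0_l, Rmult_1_l, exp_ln, cos_0, sin_0 by auto. apply C_ext; simpl; ring.
Qed.

Lemma cpow_pos_opp_l (x : R) (z : C) : cpow_pos x z * cpow_pos x (- z) = 1.
Proof. rewrite <- cpow_pos_plus. replace (z + - z) with (RtoC 0) by ring. apply cpow_pos_0. Qed.

Lemma cpow_pos_neq_0 (x : R) (z : C) : cpow_pos x z <> 0.
Proof.
  intros H. assert (E := cpow_pos_opp_l x z). rewrite H, Cmult_0_l in E.
  apply (f_equal Re) in E; simpl in E; lra.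
Qed.

Lemma cpow_pos_opp (x : R) (z : C) : cpow_pos x (- z) = / cpow_pos x z.
Proof.
  rewrite <- (Cmult_1_r (/ _)), <- (cpow_pos_opp_l x z). field. apply cpow_pos_neq_0.
Qed.

Lemma cpow_pos_minus (x : R) (z w : C) : cpow_pos x (z - w) = cpow_pos x z / cpow_pos x w.
Proof. unfold Cminus. now rewrite cpow_pos_plus, cpow_pos_opp. Qed.

Lemma cpow_pos_mult (x y : R) (z : C) :
  (0 < x)%R -> (0 < y)%R -> cpow_pos (x * y) z = cpow_pos x z * cpow_pos y z.
Proof.
  intros Hx Hy; destruct z as [a b]; unfold cpow_pos; simpl.
  rewrite ln_mult, !Rmult_plus_distr_l, exp_plus, cos_plus, sin_plus by auto.
  apply C_ext; simpl; ring.
Qed.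

Lemma cpow_pos_div (x y : R) (z : C) :
  (0 < x)%R -> (0 < y)%R -> cpow_pos (x / y) z = cpow_pos x z / cpow_pos y z.
Proof.
  intros Hx Hy. replace x with (x / y * y)%R at 2 by (field; lra).
  rewrite cpow_pos_mult; auto; [ field; apply cpow_pos_neq_0 | now apply Rdiv_lt_0_compat ].
Qed.

Lemma Cmod_cpow_pos (x : R) (z : C) : Cmod (cpow_pos x z) = exp (Re z * ln x).
Proof.
  unfold Cmod, cpow_pos, fst, snd.
  set (e := exp _). set (t := (Im z * ln x)%R).
  replace ((e * cos t) ^ 2 + (e * sin t) ^ 2)%R
    with (e * e * (Rsqr (sin t) + Rsqr (cos t)))%R by (unfold Rsqr; ring).
  rewrite sin2_cos2, Rmult_1_r. apply sqrt_square. unfold e; left; apply exp_pos.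
Qed.

Lemma Ccv_cpow_pos (x : nat -> R) (y : R) (z : C) :
  (0 < y)%R -> is_lim_seq x y -> Ccv (fun n => cpow_pos (x n) z) (cpow_pos y z).
Proof.
  intros Hy Hx.
  assert (Hln : is_lim_seq (fun n => ln (x n)) (ln y)).
  { apply is_lim_seq_continuous; auto. apply derivable_continuous_pt.
    exists (/ y)%R. apply derivable_pt_lim_ln, Hy. }
  assert (HL : forall c : R, is_lim_seq (fun n => (c * ln (x n))%R) (c * ln y)%R).
  { intros c; apply is_lim_seq_mult'; auto; apply is_lim_seq_const. }
  split; simpl; apply is_lim_seq_mult'; apply is_lim_seq_continuous; auto;
    apply derivable_continuous_pt;
    (apply derivable_pt_exp || apply derivable_pt_cos || apply derivable_pt_sin).
Qed.

(* [d/dt (1 + z t)(1 - t)^z = - z (z + 1) t (1 - t)^(z - 1)], so the first-order term vanishes. *)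
Lemma Gauss_factor_estimate (z : C) :
  exists M, (0 <= M)%R /\ forall h, (0 <= h <= 1 / 2)%R ->
    (Cmod ((1 + z * RtoC h) * cpow_pos (1 - h) z - 1) <= M * h ^ 2)%R.
Proof.
  destruct z as [x y].
  (* [p] and [q] are the real and imaginary parts of [z (z + 1)]. *)
  set (p := (x + x ^ 2 - y ^ 2)%R). set (q := (y + 2 * x * y)%R).
  (* For [t <= 1/2], the 2 bounds [1 / (1 - t)] and the exponential bounds [|(1 - t)^z|]. *)
  set (B := (2 * (exp (Rabs x * ln 2) * (Rabs p + Rabs q)))%R).
  assert (HB : (0 <= B)%R).
  { unfold B. apply Rmult_le_pos; [ lra | ]. apply Rmult_le_pos; [ left; apply exp_pos | ].
    generalize (Rabs_pos p) (Rabs_pos q); lra. }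
  assert (Hexp : forall t, (0 <= t <= 1 / 2)%R ->
     (exp (x * ln (1 - t)) <= exp (Rabs x * ln 2))%R).
  { intros t Ht.
    assert (H1 : (ln (1 - t) <= 0)%R) by (rewrite <- ln_1; apply ln_le; lra).
    assert (H2 : (- ln 2 <= ln (1 - t))%R) by (rewrite <- ln_Rinv by lra; apply ln_le; lra).
    assert (H3 : (x * ln (1 - t) <= Rabs x * ln 2)%R).
    { apply Rle_trans with (Rabs (x * ln (1 - t))); [ apply Rle_abs | ].
      rewrite Rabs_mult. apply Rmult_le_compat_l; [ apply Rabs_pos | ].
      rewrite Rabs_left1 by lra. lra. }
    destruct H3 as [H3 | H3]; [ left; now apply exp_increasing | rewrite H3; lra ]. }
  (* One bound for both components of the derivative: the pair [(A, D)] is [(p, q)] or [(q, p)], and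
     signs are absorbed in [s]. *)
  assert (Hder : forall t c s A D, (0 <= t <= 1 / 2)%R -> (Rabs c <= 1)%R -> (Rabs s <= 1)%R ->
     A = p \/ A = q -> D = p \/ D = q -> (A = p -> D = q) -> (A = q -> D = p) ->
     (Rabs (- (t / (1 - t)) * (exp (x * ln (1 - t)) * (A * c + D * s))) <= B * t)%R).
  { intros t c s A D Ht Hc Hs HA HD HAD HDA.
    assert (HS : (Rabs A + Rabs D = Rabs p + Rabs q)%R).
    { destruct HA as [HA | HA]; [ rewrite (HAD HA), HA | rewrite (HDA HA), HA ]; ring. }
    rewrite Rabs_mult, Rabs_Ropp, Rabs_mult.
    rewrite (Rabs_pos_eq (t / (1 - t))) by (apply Rmult_le_pos; [ lra | left; apply Rinv_0_lt_compat; lra ]).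
    rewrite (Rabs_pos_eq (exp _)) by (left; apply exp_pos).
    assert (H1 : (t / (1 - t) <= 2 * t)%R).
    { apply Rmult_le_reg_r with (1 - t)%R; [ lra | ].
      unfold Rdiv; rewrite Rmult_assoc, Rinv_l by lra. nra. }
    assert (H2 : (Rabs (A * c + D * s) <= Rabs p + Rabs q)%R).
    { eapply Rle_trans; [ apply Rabs_triang | ]. rewrite !Rabs_mult.
      generalize (Rabs_pos A) (Rabs_pos D) (Rabs_pos c) (Rabs_pos s); intros; nra. }
    assert (H3 : (exp (x * ln (1 - t)) * Rabs (A * c + D * s) <= exp (Rabs x * ln 2) * (Rabs p + Rabs q))%R).
    { apply Rmult_le_compat; auto; [ left; apply exp_pos | apply Rabs_pos ]. }
    unfold B.
    apply Rle_trans with (2 * t * (exp (Rabs x * ln 2) * (Rabs p + Rabs q)))%R; [ | right; ring ].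
    apply Rmult_le_compat; auto.
    - apply Rmult_le_pos; [ lra | left; apply Rinv_0_lt_compat; lra ].
    - apply Rmult_le_pos; [ left; apply exp_pos | apply Rabs_pos ]. }
  assert (MV : forall f df : R -> R,
     (forall t, (0 <= t <= 1 / 2)%R -> is_derive f t (df t)) ->
     (forall t, (0 <= t <= 1 / 2)%R -> (Rabs (df t) <= B * t)%R) ->
     forall h, (0 <= h <= 1 / 2)%R -> (Rabs (f h - f 0%R) <= B * h ^ 2)%R).
  { intros f df Hf Hd h Hh.
    destruct (MVT_gen f 0%R h df) as [c [Hc E]].
    - rewrite Rmin_left, Rmax_right by lra. intros t Ht; apply Hf; lra.
    - rewrite Rmin_left, Rmax_right by lra. intros t Ht.
      apply derivable_continuous_pt. exists (df t). apply is_derive_Reals, Hf; lra.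
    - rewrite Rmin_left, Rmax_right in Hc by lra.
      rewrite E, Rabs_mult, (Rabs_pos_eq (h - 0)) by lra.
      replace (B * h ^ 2)%R with (B * h * (h - 0))%R by ring.
      apply Rmult_le_compat_r; [ lra | ].
      apply Rle_trans with (B * c)%R; [ apply Hd; lra | apply Rmult_le_compat_l; lra ]. }
  (* The mean value theorem is real, so the two components are estimated separately and their bounds
     added. *)
  exists (B + B)%R; split; [ lra | ]. intros h Hh.
  set (f := fun t : R => ((1 + x * t) * (exp (x * ln (1 - t)) * cos (y * ln (1 - t)))
       - y * t * (exp (x * ln (1 - t)) * sin (y * ln (1 - t))))%R).
  set (g := fun t : R => ((1 + x * t) * (exp (x * ln (1 - t)) * sin (y * ln (1 - t)))
       + y * t * (exp (x * ln (1 - t)) * cos (y * ln (1 - t))))%R).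
  assert (Hc : forall w, (Rabs (cos w) <= 1)%R) by (intros w; apply Rabs_le; generalize (COS_bound w); lra).
  assert (Hs : forall w, (Rabs (sin w) <= 1)%R) by (intros w; apply Rabs_le; generalize (SIN_bound w); lra).
  assert (Hf : (Rabs (f h - f 0%R) <= B * h ^ 2)%R).
  { apply (MV f (fun t => - (t / (1 - t)) * (exp (x * ln (1 - t)) *
        (p * cos (y * ln (1 - t)) + q * - sin (y * ln (1 - t)))))%R); [ | | exact Hh ].
    - intros t Ht. unfold f. auto_derive; [ repeat split; lra | ].
      change (1 + - t)%R with (1 - t)%R. unfold p, q; field; lra.
    - intros t Ht; apply Hder; auto; rewrite ?Rabs_Ropp; auto. }
  assert (Hg : (Rabs (g h - g 0%R) <= B * h ^ 2)%R).
  { apply (MV g (fun t => - (t / (1 - t)) * (exp (x * ln (1 - t)) *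
        (q * cos (y * ln (1 - t)) + p * sin (y * ln (1 - t)))))%R); [ | | exact Hh ].
    - intros t Ht. unfold g. auto_derive; [ repeat split; lra | ].
      change (1 + - t)%R with (1 - t)%R. unfold p, q; field; lra.
    - intros t Ht; apply Hder; auto. }
  assert (Hf0 : f 0%R = 1%R).
  { unfold f. rewrite Rminus_0_r, ln_1, !Rmult_0_r, exp_0, cos_0; ring. }
  assert (Hg0 : g 0%R = 0%R).
  { unfold g. rewrite Rminus_0_r, ln_1, !Rmult_0_r, sin_0; ring. }
  rewrite Hf0 in Hf; rewrite Hg0 in Hg.
  eapply Rle_trans; [ apply Cmod_le_Re_Im | ].
  unfold cpow_pos; simpl.
  match goal with |- (Rabs ?u + Rabs ?v <= _)%R =>
    replace u with (f h - 1)%R by (unfold f; ring); replace v with (g h - 0)%R by (unfold g; ring) end.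
  simpl in Hf, Hg. lra.
Qed.

(** A discrete Gronwall inequality: each factor is at most [1 + M d <= exp (M d)], and the
    increments [d] telescope in the exponent. *)
Lemma product_bounded (q : nat -> C) (M : R) :
  (0 <= M)%R ->
  (forall n, (Cmod (q (S n) - q n) <= M * (/ INR (S n) - / INR (S (S n))) * Cmod (q n))%R) ->
  forall n, (Cmod (q n) <= Cmod (q O) * exp (M * (1 - / INR (S n))))%R.
Proof.
  intros HM H; induction n as [ | n IH ].
  - simpl. replace (M * (1 - / 1))%R with 0%R by field. rewrite exp_0; lra.
  - set (d := (/ INR (S n) - / INR (S (S n)))%R) in *.
    assert (H1 : (Cmod (q (S n)) <= (1 + M * d) * Cmod (q n))%R).
    { replace (q (S n)) with ((q (S n) - q n) + q n) by ring.
      eapply Rle_trans; [ apply Cmod_triangle | ]. specialize (H n). fold d in H. lra. }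
    eapply Rle_trans; [ exact H1 | ].
    replace (M * (1 - / INR (S (S n))))%R with (M * d + M * (1 - / INR (S n)))%R by (unfold d; ring).
    rewrite exp_plus.
    assert (Hd : (0 <= d)%R).
    { unfold d. assert (/ INR (S (S n)) <= / INR (S n))%R; [ | lra ].
      apply Rinv_le_contravar; [ apply lt_0_INR; lia | apply le_INR; lia ]. }
    assert (H2 : (1 + M * d <= exp (M * d))%R).
    { destruct (Req_dec (M * d) 0) as [-> | Hn]; [ rewrite exp_0; lra | left; now apply exp_ineq1 ]. }
    replace (Cmod (q 0%nat) * (exp (M * d) * exp (M * (1 - / INR (S n)))))%R
      with (exp (M * d) * (Cmod (q 0%nat) * exp (M * (1 - / INR (S n)))))%R by ring.
    apply Rmult_le_compat; auto using Cmod_ge_0. assert (0 <= M * d)%R by now apply Rmult_le_pos. lra.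
Qed.

Lemma product_cv (q : nat -> C) (M : R) :
  (0 <= M)%R ->
  (forall n, (Cmod (q (S n) - q n) <= M * (/ INR (S n) - / INR (S (S n))) * Cmod (q n))%R) ->
  exists l, Ccv q l.
Proof.
  intros HM H.
  set (A := (Cmod (q O) * exp M)%R).
  assert (HA0 : (0 <= A)%R) by (apply Rmult_le_pos; [ apply Cmod_ge_0 | left; apply exp_pos ]).
  assert (HA : forall n, (Cmod (q n) <= A)%R).
  { intros n; eapply Rle_trans; [ now apply (product_bounded q M) | ].
    apply Rmult_le_compat_l; [ apply Cmod_ge_0 | ].
    assert (0 < / INR (S n))%R by (apply Rinv_0_lt_compat, lt_0_INR; lia).
    destruct HM as [HM | <-]; [ left; apply exp_increasing; nra | rewrite Rmult_0_l; lra ]. }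
  destruct (telescoping_cv q (M * A)) as [l [Hl _]]; [ now apply Rmult_le_pos | | now exists l ].
  intros n; eapply Rle_trans; [ apply H | ].
  assert (/ INR (S (S n)) <= / INR (S n))%R
    by (apply Rinv_le_contravar; [ apply lt_0_INR; lia | apply le_INR; lia ]).
  replace (M * A * (/ INR (S n) - / INR (S (S n))))%R
    with (M * (/ INR (S n) - / INR (S (S n))) * A)%R by ring.
  apply Rmult_le_compat_l; auto. apply Rmult_le_pos; lra.
Qed.

(** Far enough out each factor has modulus at least [1 - M d >= exp (- 2 M d)]; the exponents
    telescope, so the moduli stay above a positive constant. *)
Lemma product_lim_neq_0 (q : nat -> C) (M : R) (l : C) :
  (0 <= M)%R ->
  (forall n, (Cmod (q (S n) - q n) <= M * (/ INR (S n) - / INR (S (S n))) * Cmod (q n))%R) ->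
  (forall n, q n <> 0) -> Ccv q l -> l <> 0.
Proof.
  intros HM H Hq Hl E; subst l.
  destruct (INR_unbounded (2 * M)) as [N HN].
  set (r n := (/ INR (S n))%R).
  assert (Hr : forall n, (0 < r (S n) <= r n)%R).
  { intros n; unfold r; split; [ apply Rinv_0_lt_compat, lt_0_INR; lia | ].
    apply Rinv_le_contravar; [ apply lt_0_INR; lia | apply le_INR; lia ]. }
  assert (HrN : forall n, (N <= n)%nat -> (M * r n <= 1 / 2)%R).
  { intros n Hn. unfold r. apply le_INR in Hn. rewrite S_INR.
    assert (0 <= INR n)%R by apply pos_INR.
    apply Rmult_le_reg_r with (INR n + 1)%R; [ lra | ].
    rewrite Rmult_assoc, Rinv_l by lra. lra. }
  assert (LB : forall k, (Cmod (q N) * exp (- (2 * M) * (r N - r (N + k)%nat)) <= Cmod (q (N + k)%nat))%R).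
  { induction k as [ | k IH ].
    - rewrite Nat.add_0_r, Rminus_diag, Rmult_0_r, exp_0; lra.
    - rewrite Nat.add_succ_r. set (n := (N + k)%nat) in *.
      set (d := (r n - r (S n))%R).
      assert (Hd : (0 <= d)%R) by (generalize (Hr n); unfold d; lra).
      assert (Hd2 : (M * d <= 1 / 2)%R).
      { assert (Ha := HrN n ltac:(unfold n; lia)). generalize (Hr n); unfold d; intros; nra. }
      assert (H1 : ((1 - M * d) * Cmod (q n) <= Cmod (q (S n)))%R).
      { assert (Ht := Cmod_triangle (q (S n)) (- (q (S n) - q n))).
        replace (q (S n) + - (q (S n) - q n)) with (q n) in Ht by ring.
        rewrite Cmod_opp in Ht. specialize (H n). fold (r n) (r (S n)) in H. fold d in H. lra. }
      eapply Rle_trans; [ | exact H1 ].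
      replace (- (2 * M) * (r N - r (S n)))%R with (- (2 * (M * d)) + - (2 * M) * (r N - r n))%R by (unfold d; ring).
      rewrite exp_plus.
      (* With [x = M d <= 1/2], this follows from [1 + 2 x <= exp (2 x)] and
         [(1 - x)(1 + 2 x) = 1 + x (1 - 2 x) >= 1]. *)
      assert (H2 : (exp (- (2 * (M * d))) <= 1 - M * d)%R).
      { rewrite exp_Ropp. apply Rmult_le_reg_l with (exp (2 * (M * d)))%R; [ apply exp_pos | ].
        rewrite Rinv_r by (apply Rgt_not_eq, exp_pos).
        assert (H3 : (1 + 2 * (M * d) <= exp (2 * (M * d)))%R).
        { destruct (Req_dec (2 * (M * d)) 0) as [-> | Hn]; [ rewrite exp_0; lra | left; now apply exp_ineq1 ]. }
        assert (0 <= M * d)%R by now apply Rmult_le_pos. nra. }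
      replace (Cmod (q N) * (exp (- (2 * (M * d))) * exp (- (2 * M) * (r N - r n))))%R
        with (exp (- (2 * (M * d))) * (Cmod (q N) * exp (- (2 * M) * (r N - r n))))%R by ring.
      apply Rmult_le_compat; auto; [ left; apply exp_pos | ].
      apply Rmult_le_pos; [ apply Cmod_ge_0 | left; apply exp_pos ]. }
  set (A := (Cmod (q N) * exp (- (2 * M) * r N))%R).
  assert (HA : (0 < A)%R) by (apply Rmult_lt_0_compat; [ now apply Cmod_gt_0 | apply exp_pos ]).
  assert (HAq : forall n, (N <= n)%nat -> (A <= Cmod (q n))%R).
  { intros n Hn. replace n with (N + (n - N))%nat by lia.
    eapply Rle_trans; [ | apply LB ]. unfold A. apply Rmult_le_compat_l; [ apply Cmod_ge_0 | ].
    assert (Hp : (0 < r (N + (n - N))%nat)%R) by (unfold r; apply Rinv_0_lt_compat, lt_0_INR; lia).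
    destruct HM as [HM | <-]; [ left; apply exp_increasing; nra | right; f_equal; ring ]. }
  assert (X := is_lim_seq_le_loc (fun _ => A) _ (Finite A) _
     (ex_intro _ N HAq) (is_lim_seq_const A) (Ccv_Cmod_lim _ _ Hl)).
  simpl in X. rewrite Cmod_0 in X. lra.
Qed.

(** * The reciprocal Gamma function *)

Lemma RtoC_INR_S (n : nat) : RtoC (INR (S n)) = RtoC (INR n) + 1.
Proof. now rewrite S_INR, RtoC_plus. Qed.

Lemma RtoC_neq_0 (x : R) : x <> 0%R -> RtoC x <> 0.
Proof. intros H E; apply H. now apply (f_equal Re) in E. Qed.

Lemma RtoC_INR_neq_0 (n : nat) : (0 < n)%nat -> RtoC (INR n) <> 0.
Proof. intros H; apply RtoC_neq_0, not_0_INR; lia. Qed.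

Lemma RtoC_fact_neq_0 (n : nat) : RtoC (INR (fact n)) <> 0.
Proof. apply RtoC_neq_0, INR_fact_neq_0. Qed.

Lemma RtoC_fact_S (n : nat) : RtoC (INR (fact (S n))) = (RtoC (INR n) + 1) * RtoC (INR (fact n)).
Proof. now rewrite fact_simpl, mult_INR, RtoC_mult, RtoC_INR_S. Qed.

Lemma Cinv_neq_0 (z : C) : z <> 0 -> / z <> 0.
Proof. intros H E. apply C1_nz. rewrite <- (Cinv_r z H), E. ring. Qed.

Lemma Cinv_mult (z w : C) : / (z * w) = / z * / w.
Proof.
  assert (H0 : / 0 = 0) by (apply C_ext; simpl; unfold Rdiv; ring).
  destruct (Ceq_dec z 0) as [-> | Hz]; [ rewrite Cmult_0_l, H0; ring | ].
  destruct (Ceq_dec w 0) as [-> | Hw]; [ rewrite Cmult_0_r, H0; ring | ].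
  now field.
Qed.

Lemma poch_S (a : C) (n : nat) : poch a (S n) = poch a n * (a + RtoC (INR n)).
Proof. reflexivity. Qed.

Lemma poch_S_l (a : C) (n : nat) : poch a (S n) = a * poch (a + 1) n.
Proof.
  induction n as [ | n IH ].
  - unfold poch; simpl. ring.
  - rewrite poch_S, IH, (poch_S _ n), RtoC_INR_S. ring.
Qed.

Lemma poch_shift (a : C) (n : nat) : a * poch (a + 1) n = poch a n * (a + RtoC (INR n)).
Proof. now rewrite <- poch_S_l, <- poch_S. Qed.

Lemma nonpos_int_neq_0 (a : C) (n : nat) : ~ nonpos_int a -> a + RtoC (INR n) <> 0.
Proof.
  intros H E; apply H; exists n.
  replace a with (a + RtoC (INR n) - RtoC (INR n)) by ring. rewrite E; ring.
Qed.

Lemma not_nonpos_int_plus (a : C) (n : nat) : ~ nonpos_int a -> ~ nonpos_int (a + RtoC (INR n)).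
Proof.
  intros H [k E]. apply H; exists (n + k)%nat. rewrite plus_INR, RtoC_plus.
  replace a with (a + RtoC (INR n) - RtoC (INR n)) by ring. rewrite E; ring.
Qed.

Lemma not_nonpos_int_Re (a : C) : (0 < Re a)%R -> ~ nonpos_int a.
Proof.
  intros H [k ->]. simpl in H. generalize (pos_INR k); lra.
Qed.

Lemma poch_neq_0 (a : C) (n : nat) : ~ nonpos_int a -> poch a n <> 0.
Proof.
  intros H; induction n as [ | n IH ].
  - apply C1_nz.
  - rewrite poch_S. apply Cmult_neq_0; auto using nonpos_int_neq_0.
Qed.

(** The reciprocal of [Gauss_seq]: the Pochhammer product moves to the numerator, so the poles of
    Gamma become zeros. *)
Definition rGauss_seq (z : C) (n : nat) : C :=
  poch z (S n) / (RtoC (INR (fact n)) * cpow_pos (INR n) z).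

(** The comparison starts at index 1, since [cpow_pos (INR 0) z] is not a true power. It also makes
    [h = 1 / (n + 2)] at most [1/2], the range of [Gauss_factor_estimate]. *)
Lemma rGauss_seq_step (z : C) (n : nat) :
  let h := (/ INR (S (S n)))%R in
  rGauss_seq z (S (S n)) = rGauss_seq z (S n) * ((1 + z * RtoC h) * cpow_pos (1 - h) z).
Proof.
  intros h. assert (Hn : (0 < INR (S (S n)))%R) by (apply lt_0_INR; lia).
  assert (Hn' : (0 < INR (S n))%R) by (apply lt_0_INR; lia).
  assert (E : (1 - h = INR (S n) / INR (S (S n)))%R).
  { unfold h. rewrite (S_INR (S n)) in *. field. lra. }
  rewrite E, cpow_pos_div by auto. unfold rGauss_seq, h.
  rewrite (poch_S _ (S (S n))), RtoC_fact_S, RtoC_inv by lra.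
  rewrite <- RtoC_INR_S. field. repeat split;
    auto using cpow_pos_neq_0, RtoC_fact_neq_0; apply RtoC_INR_neq_0; lia.
Qed.

Lemma rGauss_seq_variation (z : C) :
  exists M, (0 <= M)%R /\ forall n,
    (Cmod (rGauss_seq z (S (S n)) - rGauss_seq z (S n))
       <= M * (/ INR (S n) - / INR (S (S n))) * Cmod (rGauss_seq z (S n)))%R.
Proof.
  destruct (Gauss_factor_estimate z) as [M [HM H]].
  exists M; split; auto. intros n. rewrite rGauss_seq_step. set (h := (/ INR (S (S n)))%R).
  set (w := _ * cpow_pos _ _) at 1.
  replace (rGauss_seq z (S n) * w - rGauss_seq z (S n)) with ((w - 1) * rGauss_seq z (S n)) by ring.
  rewrite Cmod_mult. apply Rmult_le_compat_r; [ apply Cmod_ge_0 | ].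
  assert (Hn : (0 <= INR n)%R) by apply pos_INR.
  assert (Hh : (0 <= h <= 1 / 2)%R).
  { unfold h; rewrite !S_INR; split; [ left; apply Rinv_0_lt_compat; lra | ].
    replace (1 / 2)%R with (/ 2)%R by field. apply Rinv_le_contravar; lra. }
  eapply Rle_trans; [ now apply H | ].
  (* It remains that [h^2 = 1 / (n+2)^2] is at most [1 / ((n+1)(n+2))]. *)
  apply Rmult_le_compat_l; auto.
  unfold h; rewrite !S_INR.
  replace (/ (INR n + 1) - / (INR n + 1 + 1))%R
    with (/ (INR n + 1) * / (INR n + 1 + 1))%R by (field; lra).
  simpl; rewrite Rmult_1_r. apply Rmult_le_compat_r; [ left; apply Rinv_0_lt_compat; lra | ].
  apply Rinv_le_contravar; lra.
Qed.

Lemma rGauss_seq_ex_cv (z : C) : exists l, Ccv (rGauss_seq z) l.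
Proof.
  destruct (rGauss_seq_variation z) as [M [HM H]].
  destruct (product_cv (fun n => rGauss_seq z (S n)) M HM H) as [l Hl].
  exists l. now apply Ccv_incr.
Qed.

(* The entire function [1 / Gamma]. *)
Definition rGamma (z : C) : C := Clim (rGauss_seq z).

Lemma rGamma_cv (z : C) : Ccv (rGauss_seq z) (rGamma z).
Proof. apply Clim_cv, rGauss_seq_ex_cv. Qed.

Lemma rGamma_neq_0 (z : C) : ~ nonpos_int z -> rGamma z <> 0.
Proof.
  intros Hz. destruct (rGauss_seq_variation z) as [M [HM H]].
  apply (product_lim_neq_0 (fun n => rGauss_seq z (S n)) M _ HM H).
  - intros n. unfold rGauss_seq, Cdiv. apply Cmult_neq_0; [ now apply poch_neq_0 | ].
    apply Cinv_neq_0.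
    apply Cmult_neq_0; auto using RtoC_fact_neq_0, cpow_pos_neq_0.
  - apply Ccv_incr with (u := rGauss_seq z), rGamma_cv.
Qed.

(** [lim] is specified only on Cauchy filters, so convergence of the Gauss quotients is established
    first; completeness then makes [CGamma z] a limit of the same sequence, and limits are
    unique. *)
Lemma CGamma_rGamma (z : C) : ~ nonpos_int z -> CGamma z = / rGamma z.
Proof.
  intros Hz.
  assert (H : Ccv (Gauss_seq z) (/ rGamma z)).
  { apply (Ccv_ext (fun n => / rGauss_seq z n)).
    - intros n. unfold rGauss_seq, Gauss_seq. fold (poch z (S n)).
      field. auto using RtoC_fact_neq_0, cpow_pos_neq_0, poch_neq_0.
    - apply Ccv_inv; auto using rGamma_neq_0, rGamma_cv. }
  symmetry; apply (Ccv_unique (Gauss_seq z)); auto.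
  apply Ccv_filterlim, filterlim_locally. apply Ccv_filterlim in H.
  intros eps; refine (complete_cauchy (T := C_CompleteNormedModule) (filtermap (Gauss_seq z) eventually) _ _ eps).
  intros e. exists (/ rGamma z). exact (proj1 (filterlim_locally _ _) H e).
Qed.

Lemma Ccv_ratio_nat (c : C) : Ccv (fun n => (c + RtoC (INR n)) / RtoC (INR n)) 1.
Proof.
  apply (Ccv_ext (fun n => (c + RtoC (INR (1 * n))) / (0 + RtoC (INR (1 * n))))).
  - intros n. now rewrite Nat.mul_1_l, Cplus_0_l.
  - apply Ccv_ratio_affine; lia.
Qed.

Lemma rGamma_S (z : C) : rGamma z = z * rGamma (z + 1).
Proof.
  apply (Ccv_unique (fun n => (z + 1 + RtoC (INR n)) / RtoC (INR n) * rGauss_seq z n)).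
  - apply (Ccv_eq _ (1 * rGamma z)); [ | ring ].
    apply Ccv_mult; [ apply Ccv_ratio_nat | apply rGamma_cv ].
  - apply (Ccv_ext_loc (fun n => z * rGauss_seq (z + 1) n)); [ | apply Ccv_scal, rGamma_cv ].
    exists 1%nat; intros n Hn. unfold rGauss_seq.
    rewrite cpow_pos_plus, cpow_pos_1 by (apply lt_0_INR; lia).
    unfold Cdiv at 1. rewrite Cmult_assoc, poch_shift, RtoC_INR_S. field.
    repeat split; auto using RtoC_fact_neq_0, cpow_pos_neq_0; apply RtoC_INR_neq_0; lia.
Qed.

Lemma rGamma_poch (z : C) (n : nat) : rGamma z = poch z n * rGamma (z + RtoC (INR n)).
Proof.
  induction n as [ | n IH ].
  - unfold poch; simpl. rewrite Cplus_0_r; ring.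
  - rewrite IH, rGamma_S, poch_S, RtoC_INR_S, Cplus_assoc. ring.
Qed.

Lemma poch_1 (n : nat) : poch 1 n = RtoC (INR (fact n)).
Proof.
  induction n as [ | n IH ]; [ reflexivity | ].
  rewrite poch_S, IH, RtoC_fact_S; ring.
Qed.

Lemma rGamma_1 : rGamma 1 = 1.
Proof.
  apply (Ccv_unique (rGauss_seq 1)); [ apply rGamma_cv | ].
  apply (Ccv_ext_loc (fun n => (1 + RtoC (INR n)) / RtoC (INR n))); [ | apply Ccv_ratio_nat ].
  exists 1%nat; intros n Hn. unfold rGauss_seq.
  rewrite cpow_pos_1, poch_1, RtoC_fact_S by (apply lt_0_INR; lia). field.
  split; [ apply RtoC_INR_neq_0; lia | apply RtoC_fact_neq_0 ].
Qed.

(** The estimate [Gamma (z + n + 1) ~ n! n^z]. Away from the poles the quantity is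
    [rGamma z / rGauss_seq z n]. At a pole this is [0 / 0] for large [n], so [z] is first moved
    right by [k] and the functional equation brings the limit back. *)
Lemma rGamma_asymptotic_aux (k : nat) : forall z, ~ nonpos_int (z + RtoC (INR k)) ->
  Ccv (fun n => rGamma (z + RtoC (INR (S n))) * RtoC (INR (fact n)) * cpow_pos (INR n) z) 1.
Proof.
  induction k as [ | k IH ]; intros z Hz.
  - simpl in Hz. rewrite Cplus_0_r in Hz.
    apply (Ccv_ext (fun n => rGamma z / rGauss_seq z n)).
    + intros n. rewrite (rGamma_poch z (S n)). unfold rGauss_seq. field.
      repeat split; auto using RtoC_fact_neq_0, cpow_pos_neq_0, poch_neq_0.
    + apply (Ccv_eq _ (rGamma z / rGamma z)); [ | field; now apply rGamma_neq_0 ].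
      apply Ccv_div; auto using rGamma_neq_0, rGamma_cv, Ccv_const.
  - rewrite RtoC_INR_S in Hz. replace (z + (RtoC (INR k) + 1)) with (z + 1 + RtoC (INR k)) in Hz by ring.
    specialize (IH _ Hz).
    apply (Ccv_ext_loc (fun n => (z + 1 + RtoC (INR n)) / RtoC (INR n) *
       (rGamma (z + 1 + RtoC (INR (S n))) * RtoC (INR (fact n)) * cpow_pos (INR n) (z + 1)))).
    + exists 1%nat; intros n Hn. rewrite (rGamma_S (z + _)).
      rewrite cpow_pos_plus, cpow_pos_1 by (apply lt_0_INR; lia). rewrite RtoC_INR_S.
      replace (z + (RtoC (INR n) + 1) + 1) with (z + 1 + (RtoC (INR n) + 1)) by ring. field. apply RtoC_INR_neq_0; lia.
    + apply (Ccv_eq _ (1 * 1)); [ | ring ]. apply Ccv_mult; auto using Ccv_ratio_nat.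
Qed.

Lemma rGamma_asymptotic (z : C) :
  Ccv (fun n => rGamma (z + RtoC (INR (S n))) * RtoC (INR (fact n)) * cpow_pos (INR n) z) 1.
Proof.
  destruct (INR_unbounded (Cmod z)) as [k Hk]. apply (rGamma_asymptotic_aux k).
  apply not_nonpos_int_Re. simpl.
  assert (H := re_le_Cmod z). apply Rabs_le_between in H. unfold Re in H. lra.
Qed.

Lemma poch_double (z : C) (n : nat) :
  poch (2 * z) (2 * n) = 4 ^ n * poch z n * poch (z + 1 / 2) n.
Proof.
  induction n as [ | n IH ].
  - unfold poch; simpl; ring.
  - replace (2 * S n)%nat with (S (S (2 * n))) by lia.
    rewrite !poch_S, IH, Cpow_S, RtoC_INR_S, mult_INR, RtoC_mult. simpl (INR 2).
    rewrite RtoC_plus. field.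
Qed.

Lemma cpow_pos_base_1 (z : C) : cpow_pos 1 z = 1.
Proof.
  unfold cpow_pos. rewrite ln_1, !Rmult_0_r, exp_0, cos_0, sin_0. apply C_ext; simpl; ring.
Qed.

(** Legendre's formula from Gauss products alone: at the odd index [2 n + 1] the product for [2 z]
    has [2 (n + 1)] factors, which split evenly between [z] and [z + 1/2]. *)
Lemma rGamma_duplication (z : C) :
  rGamma (2 * z) * rGamma (1 / 2) = cpow_pos 2 (1 - 2 * z) * rGamma z * rGamma (z + 1 / 2).
Proof.
  assert (Hsub : filterlim (fun n => S (2 * n))%nat eventually eventually).
  { intros P [N HN]; exists N; intros n Hn; apply HN; lia. }
  assert (Hx : is_lim_seq (fun n => (INR n / INR (S (2 * n)))%R) (1 / 2)%R).
  { apply (is_lim_seq_ext (fun n => (1 / 2 - 1 / 2 * / INR (S (2 * n)))%R)).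
    - intros n. rewrite S_INR, mult_INR. simpl (INR 2). field. generalize (pos_INR n); lra.
    - replace (Finite (1 / 2)) with (Finite (1 / 2 - 1 / 2 * 0)) by (f_equal; field).
      apply is_lim_seq_minus'; [ apply is_lim_seq_const | ].
      apply is_lim_seq_mult'; [ apply is_lim_seq_const | ].
      apply (is_lim_seq_subseq (fun n => / INR (S n))%R _ (fun n => 2 * n)%nat);
        [ | apply is_lim_seq_inv_S ].
      intros P [N HN]; exists N; intros n Hn; apply HN; lia. }
  apply (Ccv_unique (fun n => rGauss_seq (2 * z) (S (2 * n)) * rGauss_seq (1 / 2) n * rGauss_seq 1 n)).
  - apply (Ccv_eq _ (rGamma (2 * z) * rGamma (1 / 2) * rGamma 1)); [ | rewrite rGamma_1; ring ].
    apply Ccv_mult; [ apply Ccv_mult | ]; try apply rGamma_cv.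
    apply (Ccv_subseq (rGauss_seq (2 * z)) _ (fun n => S (2 * n))); auto using rGamma_cv.
  - apply (Ccv_ext_loc (fun n => rGauss_seq 1 (S (2 * n)) * cpow_pos (INR n / INR (S (2 * n))) (2 * z - 1)
        * rGauss_seq z n * rGauss_seq (z + 1 / 2) n)).
    + exists 1%nat; intros n Hn.
      assert (H1 : (0 < INR n)%R) by (apply lt_0_INR; lia).
      assert (H2 : (0 < INR (S (2 * n)))%R) by (apply lt_0_INR; lia).
      rewrite cpow_pos_div by auto. unfold rGauss_seq.
      replace (S (S (2 * n))) with (2 * S n)%nat by lia.
      rewrite (poch_double z (S n)).
      (* The same splitting at [z = 1/2] relates the factorials. The auxiliary factors
         [rGauss_seq 1] carry them and tend to [rGamma 1 = 1]. *)
      replace (poch 1 (2 * S n)) with (4 ^ S n * poch (1 / 2) (S n) * poch 1 (S n)).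
      2:{ replace (poch 1 (2 * S n)) with (poch (2 * (1 / 2)) (2 * S n))
            by (f_equal; field).
          rewrite poch_double. f_equal. f_equal. field. }
      rewrite !cpow_pos_minus, !cpow_pos_1 by auto.
      replace (2 * z) with (z + z) by ring. rewrite !cpow_pos_plus.
      field. repeat split; auto using cpow_pos_neq_0, RtoC_fact_neq_0;
        apply RtoC_INR_neq_0; lia.
    + apply (Ccv_eq _ (rGamma 1 * cpow_pos (1 / 2) (2 * z - 1) * rGamma z * rGamma (z + 1 / 2))).
      * apply Ccv_mult; [ apply Ccv_mult; [ apply Ccv_mult | ] | ].
        -- apply (Ccv_subseq (rGauss_seq 1) _ (fun n => S (2 * n))); auto using rGamma_cv.
        -- apply Ccv_cpow_pos; auto; lra.
        -- apply rGamma_cv.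
        -- apply rGamma_cv.
      * rewrite rGamma_1, cpow_pos_div, cpow_pos_base_1 by lra.
        replace (1 - 2 * z) with (- (2 * z - 1)) by ring. rewrite cpow_pos_opp.
        field. apply cpow_pos_neq_0.
Qed.

(** * Telescoping contiguous relations *)

(* General term of the regularised series [2F1(a, b; c; -1) / Gamma c]. *)
Definition kterm (a b c : C) (n : nat) : C :=
  (-1) ^ n * poch a n * poch b n * rGamma (c + RtoC (INR n)) / RtoC (INR (fact n)).

Lemma csum_S (f : nat -> C) (n : nat) : csum f (S n) = csum f n + f n.
Proof. reflexivity. Qed.

(** This and the next two relations compare terms of contiguous series. Lowering [a], lowering [b]
    or raising [c] each gains a factor of order [1/n], so null terms stay null under these
    shifts. *)
Lemma kterm_S_a (a b c : C) (n : nat) :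
  (a - 1 + RtoC (INR n)) * kterm (a - 1) b c n = (a - 1) * kterm a b c n.
Proof.
  unfold kterm. assert (E := poch_shift (a - 1) n).
  replace (a - 1 + 1) with a in E by ring.
  transitivity ((-1) ^ n * (poch (a - 1) n * (a - 1 + RtoC (INR n))) * poch b n
     * rGamma (c + RtoC (INR n)) / RtoC (INR (fact n))).
  - field. apply RtoC_fact_neq_0.
  - rewrite <- E. field. apply RtoC_fact_neq_0.
Qed.

Lemma kterm_S_b (a b c : C) (n : nat) :
  (b + RtoC (INR n)) * kterm a b c n = b * kterm a (b + 1) c n.
Proof.
  unfold kterm. assert (E := poch_shift b n).
  transitivity ((-1) ^ n * poch a n * (poch b n * (b + RtoC (INR n)))
     * rGamma (c + RtoC (INR n)) / RtoC (INR (fact n))).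
  - field. apply RtoC_fact_neq_0.
  - rewrite <- E. field. apply RtoC_fact_neq_0.
Qed.

Lemma kterm_S_c (a b c : C) (n : nat) :
  (c + RtoC (INR n)) * kterm a b (c + 1) n = kterm a b c n.
Proof.
  unfold kterm. rewrite (rGamma_S (c + RtoC (INR n))).
  replace (c + RtoC (INR n) + 1) with (c + 1 + RtoC (INR n)) by ring.
  field. apply RtoC_fact_neq_0.
Qed.

Lemma kterm_0 (a b c : C) : kterm a b c 0 = rGamma c.
Proof. unfold kterm, poch; simpl. rewrite Cplus_0_r. field. Qed.

(** The difference of the two well-poised summands is an exact difference of the right-hand side.
    Once every [rGamma] is brought to a common argument, the induction step is a rational identity.
    The remainder is [- (M + 1) / (2 (b + M))] times term [M + 1] of the first series, wherever
    [b + M] is not zero. *)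
Lemma kummer_shift_b (a b : C) (M : nat) :
  csum (kterm a b (1 + a - b)) (S M)
    - (1 + a / 2 - b) * csum (kterm a (b - 1) (1 + a - (b - 1))) (S M)
  = 1 / 2 * (-1) ^ M * poch a (S M) * poch b M * rGamma (2 + a - b + RtoC (INR M))
      / RtoC (INR (fact M)).
Proof.
  induction M as [ | M IH ].
  - simpl csum. rewrite !kterm_0. simpl. rewrite (rGamma_S (1 + a - b)).
    replace (1 + a - b + 1) with (2 + a - b) by ring.
    replace (1 + a - (b - 1)) with (2 + a - b) by ring.
    unfold poch; simpl. rewrite !Cplus_0_r. field.
  - rewrite (csum_S _ (S M)), (csum_S (kterm a (b - 1) _) (S M)).
    match goal with |- ?s + ?t - ?k * (?s' + ?t') = _ =>
      replace (s + t - k * (s' + t')) with ((s - k * s') + (t - k * t')) by ring end.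
    rewrite IH; clear IH. unfold kterm.
    rewrite (poch_S_l (b - 1)). replace (b - 1 + 1) with b by ring.
    rewrite (poch_S a (S M)), (poch_S b M), Cpow_S, RtoC_fact_S, RtoC_INR_S.
    set (m := RtoC (INR M)).
    replace (1 + a - b + (m + 1)) with (2 + a - b + m) by ring.
    rewrite (rGamma_S (2 + a - b + m)).
    replace (1 + a - (b - 1) + (m + 1)) with (2 + a - b + m + 1) by ring.
    replace (2 + a - b + (m + 1)) with (2 + a - b + m + 1) by ring.
    field. repeat split; try apply RtoC_fact_neq_0.
    unfold m; rewrite <- RtoC_INR_S. apply RtoC_INR_neq_0; lia.
Qed.

(** Again an exact difference. The remainder is [(b - 1)(b + M)] times
    [kterm (a + 1) b (3 + a - b) M]: it carries an extra factor [M], so this shift is applied only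
    when the terms are [O(1/M^2)]. *)
Lemma kummer_shift_a (a b : C) (M : nat) :
  csum (kterm a b (1 + a - b)) (S M)
    - (a + 1) * (a + 2 - 2 * b) * csum (kterm (a + 2) b (1 + (a + 2) - b)) (S M)
  = - (1 - b) * (-1) ^ M * poch (a + 1) M * poch b (S M) * rGamma (3 + a - b + RtoC (INR M))
      / RtoC (INR (fact M)).
Proof.
  induction M as [ | M IH ].
  - simpl csum. rewrite !kterm_0. simpl. rewrite (rGamma_S (1 + a - b)), (rGamma_S (1 + a - b + 1)).
    replace (1 + a - b + 1 + 1) with (3 + a - b) by ring.
    replace (1 + (a + 2) - b) with (3 + a - b) by ring.
    unfold poch; simpl. rewrite !Cplus_0_r. field.
  - rewrite (csum_S _ (S M)), (csum_S (kterm (a + 2) b _) (S M)).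
    match goal with |- ?s + ?t - ?k * (?s' + ?t') = _ =>
      replace (s + t - k * (s' + t')) with ((s - k * s') + (t - k * t')) by ring end.
    rewrite IH; clear IH.
    assert (E : (a + 1) * poch (a + 2) (S M)
      = poch (a + 1) M * (a + 1 + RtoC (INR M)) * (a + 1 + (RtoC (INR M) + 1))).
    { replace (a + 2) with (a + 1 + 1) by ring. now rewrite <- poch_S_l, !poch_S, RtoC_INR_S. }
    assert (E' : (a + 1) * (a + 2 - 2 * b) * kterm (a + 2) b (1 + (a + 2) - b) (S M)
      = (a + 2 - 2 * b) * ((-1) ^ S M * ((a + 1) * poch (a + 2) (S M)) * poch b (S M) *
           rGamma (1 + (a + 2) - b + RtoC (INR (S M))) / RtoC (INR (fact (S M))))).
    { unfold kterm. field. apply RtoC_fact_neq_0. }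
    rewrite E', E; clear E E'. unfold kterm.
    rewrite (poch_S_l a), (poch_S (a + 1) M), (poch_S b (S M)), Cpow_S, RtoC_fact_S, RtoC_INR_S.
    set (m := RtoC (INR M)).
    replace (3 + a - b + m) with (1 + a - b + (m + 1) + 1) by ring.
    rewrite (rGamma_S (1 + a - b + (m + 1))), (rGamma_S (1 + a - b + (m + 1) + 1)).
    replace (1 + (a + 2) - b + (m + 1)) with (1 + a - b + (m + 1) + 1 + 1) by ring.
    replace (3 + a - b + (m + 1)) with (1 + a - b + (m + 1) + 1 + 1) by ring.
    field. repeat split; try apply RtoC_fact_neq_0.
    unfold m; rewrite <- RtoC_INR_S. apply RtoC_INR_neq_0; lia.
Qed.

(** Gauss's contiguous relation [(1 - z) F = F(a-) - z (c - b) / c F(c+)] at [z = -1], whence the 2;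
    regularisation absorbs the division by [c]. *)
Lemma contiguous_c (a b c : C) (M : nat) :
  2 * csum (kterm a b c) (S M) - csum (kterm (a - 1) b c) (S M)
    - (c - b) * csum (kterm a b (c + 1)) (S M)
  = kterm a b c M - (c - b) * kterm a b (c + 1) M.
Proof.
  induction M as [ | M IH ].
  - simpl csum. rewrite !kterm_0. ring.
  - rewrite !(csum_S _ (S M)).
    match goal with |- ?w * (?s + ?t) - (?s' + ?t') - ?k * (?s'' + ?t'') = _ =>
      replace (w * (s + t) - (s' + t') - k * (s'' + t''))
        with ((w * s - s' - k * s'') + (w * t - t' - k * t'')) by ring end.
    rewrite IH; clear IH. unfold kterm.
    rewrite (poch_S_l (a - 1)). replace (a - 1 + 1) with a by ring.
    rewrite (poch_S a), (poch_S b), Cpow_S, RtoC_fact_S, RtoC_INR_S.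
    set (m := RtoC (INR M)).
    rewrite (rGamma_S (c + m)).
    replace (c + (m + 1)) with (c + m + 1) by ring.
    replace (c + 1 + m) with (c + m + 1) by ring.
    rewrite (rGamma_S (c + m + 1)).
    replace (c + 1 + (m + 1)) with (c + m + 1 + 1) by ring.
    field. repeat split; try apply RtoC_fact_neq_0.
    unfold m; rewrite <- RtoC_INR_S. apply RtoC_INR_neq_0; lia.
Qed.

(** The counterpart that raises the second upper parameter. Its minus sign, once solved for the
    raised series, is the source of [(-1)^r] in the first identity. *)
Lemma contiguous_b (a b c : C) (M : nat) :
  2 * b * csum (kterm a (b + 1) c) (S M) - csum (kterm (a - 1) b (c - 1)) (S M)
    + (c - 1 - b) * csum (kterm a b c) (S M)
  = b * kterm a (b + 1) c M.
Proof.
  induction M as [ | M IH ].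
  - simpl csum. rewrite !kterm_0, (rGamma_S (c - 1)).
    replace (c - 1 + 1) with c by ring. ring.
  - rewrite !(csum_S _ (S M)).
    match goal with |- ?w * (?s + ?t) - (?s' + ?t') + ?k * (?s'' + ?t'') = _ =>
      replace (w * (s + t) - (s' + t') + k * (s'' + t''))
        with ((w * s - s' + k * s'') + (w * t - t' + k * t'')) by ring end.
    rewrite IH; clear IH. unfold kterm.
    rewrite (poch_S_l (a - 1)). replace (a - 1 + 1) with a by ring.
    rewrite (poch_S_l b).
    rewrite (poch_S a), (poch_S (b + 1)), Cpow_S, RtoC_fact_S, RtoC_INR_S.
    set (m := RtoC (INR M)).
    replace (c - 1 + (m + 1)) with (c + m) by ring.
    rewrite (rGamma_S (c + m)).
    replace (c + (m + 1)) with (c + m + 1) by ring.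
    field. repeat split; try apply RtoC_fact_neq_0.
    unfold m; rewrite <- RtoC_INR_S. apply RtoC_INR_neq_0; lia.
Qed.

(** * Kummer's theorem *)

Lemma ln_INR_ge_0 (n : nat) : (1 <= n)%nat -> (0 <= ln (INR n))%R.
Proof. intros Hn. rewrite <- ln_1. apply ln_le; [ lra | ]. now apply (le_INR 1). Qed.

Lemma exp_le_1 (x : R) : (x <= 0)%R -> (exp x <= 1)%R.
Proof. intros [H | ->]; rewrite <- exp_0; [ left; now apply exp_increasing | lra ]. Qed.

(** The product grows like [n^(a - c)]: the Gauss product for [a] times the asymptotics of [rGamma]
    at [c] converges, and the power left over has modulus at most 1. *)
Lemma poch_rGamma_bounded (a c : C) :
  (Re a <= Re c)%R ->
  exists B, (0 <= B)%R /\ forall n, (Cmod (poch a n * rGamma (c + RtoC (INR n))) <= B)%R.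
Proof.
  intros H.
  assert (HC := Ccv_mult _ _ _ _ (rGamma_cv a) (rGamma_asymptotic c)).
  destruct (Ccv_bounded _ _ HC) as [B [HB0 HB]].
  apply (bounded_of_eventually _ B). exists 2%nat; intros [ | n ] Hn; [ lia | ].
  specialize (HB n); cbv beta in HB.
  replace (poch a (S n) * rGamma (c + RtoC (INR (S n))))
    with (rGauss_seq a n * (rGamma (c + RtoC (INR (S n))) * RtoC (INR (fact n)) * cpow_pos (INR n) c)
          * cpow_pos (INR n) (a - c)).
  2:{ rewrite cpow_pos_minus. unfold rGauss_seq. field.
      auto using RtoC_fact_neq_0, cpow_pos_neq_0. }
  rewrite Cmod_mult. rewrite <- (Rmult_1_r B).
  apply Rmult_le_compat; auto using Cmod_ge_0.
  rewrite Cmod_cpow_pos. apply exp_le_1. simpl Re.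
  assert (Hl := ln_INR_ge_0 n ltac:(lia)). unfold Re in *. simpl. nra.
Qed.

(** [(b)_n / n!] is of order [n^(b - 1)], hence [O(1/n^2)] here. The bound involves [b] alone, which
    later makes it a dominating sequence uniform in [a]. *)
Lemma binomial_coeff_bound (b : C) :
  (Re b <= -1)%R ->
  exists D, (0 <= D)%R /\ forall n,
    (Cmod (poch b n / RtoC (INR (fact n))) <= D * (/ INR (S n) - / INR (S (S n))))%R.
Proof.
  intros Hb. destruct (Ccv_bounded _ _ (rGamma_cv b)) as [B [HB0 HB]].
  (* The 6 is the largest value, at [n = 1], of [(n+2)(n+3) / (n (n+1))]. *)
  destruct (bounded_of_eventually
    (fun n => poch b n / RtoC (INR (fact n)) * RtoC (INR (S n) * INR (S (S n)))) (6 * B)) as [D [HD0 HD]].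
  - exists 2%nat; intros [ | n ] Hn; [ lia | ].
    assert (Hn1 : (1 <= INR n)%R) by (apply (le_INR 1); lia).
    assert (Hl := ln_INR_ge_0 n ltac:(lia)).
    replace (poch b (S n) / RtoC (INR (fact (S n))))
      with (rGauss_seq b n * cpow_pos (INR n) b / RtoC (INR (S n))).
    2:{ unfold rGauss_seq. rewrite RtoC_fact_S, <- RtoC_INR_S. field.
        repeat split; auto using RtoC_fact_neq_0, cpow_pos_neq_0; apply RtoC_INR_neq_0; lia. }
    unfold Cdiv. rewrite !Cmod_mult, Cmod_inv by (apply RtoC_INR_neq_0; lia).
    rewrite Cmod_cpow_pos, !Cmod_R, Rabs_pos_eq by apply pos_INR.
    rewrite (Rabs_pos_eq (_ * _)) by (apply Rmult_le_pos; apply pos_INR).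
    assert (He : (exp (Re b * ln (INR n)) <= / INR n)%R).
    { rewrite <- (exp_ln (INR n)) at 2 by lra. rewrite <- exp_Ropp.
      assert (Hx : (Re b * ln (INR n) <= - ln (INR n))%R) by nra.
      destruct Hx as [Hx | ->]; [ left; now apply exp_increasing | lra ]. }
    specialize (HB n). rewrite !S_INR. set (x := INR n) in *.
    replace (Cmod (rGauss_seq b n) * exp (Re b * ln x) * / (x + 1) * ((x + 1 + 1) * (x + 1 + 1 + 1)))%R
      with (Cmod (rGauss_seq b n) * (exp (Re b * ln x) * (/ (x + 1) * ((x + 1 + 1) * (x + 1 + 1 + 1)))))%R by ring.
    rewrite (Rmult_comm 6). apply Rmult_le_compat; auto using Cmod_ge_0.
    { apply Rmult_le_pos; [ left; apply exp_pos | ].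
      apply Rmult_le_pos; [ left; apply Rinv_0_lt_compat; lra | nra ]. }
    apply Rle_trans with (/ x * (/ (x + 1) * ((x + 1 + 1) * (x + 1 + 1 + 1))))%R.
    { apply Rmult_le_compat_r; auto.
      apply Rmult_le_pos; [ left; apply Rinv_0_lt_compat; lra | nra ]. }
    apply Rmult_le_reg_l with (x * (x + 1))%R; [ nra | ].
    replace (x * (x + 1) * (/ x * (/ (x + 1) * ((x + 1 + 1) * (x + 1 + 1 + 1)))))%R
      with ((x + 1 + 1) * (x + 1 + 1 + 1))%R by (field; lra).
    nra.
  - exists D; split; auto. intros n. specialize (HD n); cbv beta in HD.
    rewrite Cmod_mult, Cmod_R, Rabs_pos_eq in HD by (apply Rmult_le_pos; apply pos_INR).
    assert (Hp : (0 <= INR n)%R) by apply pos_INR.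
    rewrite !S_INR in *.
    apply Rmult_le_reg_r with ((INR n + 1) * (INR n + 1 + 1))%R; [ nra | ].
    eapply Rle_trans; [ exact HD | ]. right. field. lra.
Qed.

Lemma Cmod_pow_m1 (n : nat) : Cmod ((-1) ^ n) = 1%R.
Proof.
  rewrite Cmod_pow. replace (Cmod (-1)) with 1%R; [ apply pow1 | ].
  rewrite Cmod_R, Rabs_left; lra.
Qed.

Lemma csum_cv_dominated (u : nat -> C) (D : R) :
  (0 <= D)%R ->
  (forall n, (Cmod (u n) <= D * (/ INR (S n) - / INR (S (S n))))%R) ->
  exists l, Ccv (csum u) l /\ forall n, (Cmod (l - csum u n) <= D * / INR (S n))%R.
Proof.
  intros HD H. apply telescoping_cv; auto. intros n. rewrite csum_S.
  replace (csum u n + u n - csum u n) with (u n) by ring. apply H.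
Qed.

Lemma kterm_bound (a b c : C) :
  (Re b <= -1)%R -> (Re a <= Re c)%R ->
  exists D, (0 <= D)%R /\ forall n,
    (Cmod (kterm a b c n) <= D * (/ INR (S n) - / INR (S (S n))))%R.
Proof.
  intros Hb Hac.
  destruct (binomial_coeff_bound b Hb) as [D [HD0 HD]].
  destruct (poch_rGamma_bounded a c Hac) as [B [HB0 HB]].
  exists (B * D)%R; split; [ now apply Rmult_le_pos | ]. intros n.
  unfold kterm.
  replace ((-1) ^ n * poch a n * poch b n * rGamma (c + RtoC (INR n)) / RtoC (INR (fact n)))
    with ((-1) ^ n * ((poch a n * rGamma (c + RtoC (INR n))) * (poch b n / RtoC (INR (fact n)))))
    by (field; apply RtoC_fact_neq_0).
  rewrite Cmod_mult, Cmod_pow_m1, Rmult_1_l, Cmod_mult, Rmult_assoc.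
  apply Rmult_le_compat; auto using Cmod_ge_0.
Qed.

Definition Ksum (a b : C) : C := Clim (csum (kterm a b (1 + a - b))).

Lemma Ksum_cv (a b : C) :
  (Re b <= -1)%R -> Ccv (csum (kterm a b (1 + a - b))) (Ksum a b).
Proof.
  intros Hb. apply Clim_cv.
  destruct (kterm_bound a b (1 + a - b) Hb) as [D [HD0 HD]]; [ unfold Re in *; simpl; lra | ].
  destruct (csum_cv_dominated _ D HD0 HD) as [l [Hl _]]. now exists l.
Qed.

(** Kummer's [Gamma(1 + a/2) / (Gamma(1 + a) Gamma(1 + a/2 - b))], with [Gamma(1 + a)] expanded by
    the duplication formula; in this form it is entire in [a] and [b]. *)
Definition Kvalue (a b : C) : C :=
  cpow_pos 2 (- a) * rGamma ((a + 1) / 2) * rGamma (1 + a / 2 - b) / rGamma (1 / 2).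

Lemma rGamma_half_neq_0 : rGamma (1 / 2) <> 0.
Proof. apply rGamma_neq_0, not_nonpos_int_Re. simpl. lra. Qed.

Lemma cpow_pos_2_2 : cpow_pos 2 2 = 4.
Proof.
  replace (RtoC 2) with (1 + 1) by ring. rewrite cpow_pos_plus, cpow_pos_1 by lra. ring.
Qed.

Lemma Kvalue_shift_a (a b : C) :
  Kvalue a b = (a + 1) * (a + 2 - 2 * b) * Kvalue (a + 2) b.
Proof.
  unfold Kvalue. rewrite (rGamma_S ((a + 1) / 2)), (rGamma_S (1 + a / 2 - b)).
  replace ((a + 2 + 1) / 2) with ((a + 1) / 2 + 1) by field.
  replace (1 + (a + 2) / 2 - b) with (1 + a / 2 - b + 1) by field.
  replace (- a) with (- (a + 2) + 2) by ring. rewrite cpow_pos_plus, cpow_pos_2_2.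
  field. apply rGamma_half_neq_0.
Qed.

Lemma Kvalue_shift_b (a b : C) : Kvalue a b = (1 + a / 2 - b) * Kvalue a (b - 1).
Proof.
  unfold Kvalue. rewrite (rGamma_S (1 + a / 2 - b)).
  replace (1 + a / 2 - (b - 1)) with (1 + a / 2 - b + 1) by ring.
  field. apply rGamma_half_neq_0.
Qed.

Lemma Ksum_shift_a (a b : C) :
  (Re b <= -1)%R -> Ksum a b = (a + 1) * (a + 2 - 2 * b) * Ksum (a + 2) b.
Proof.
  intros Hb.
  set (k := (a + 1) * (a + 2 - 2 * b)).
  assert (H : Ccv (fun M => csum (kterm a b (1 + a - b)) (S M)
                - k * csum (kterm (a + 2) b (1 + (a + 2) - b)) (S M)) 0).
  { apply (Ccv_ext (fun M => (b - 1) * ((b + RtoC (INR M)) * kterm (a + 1) b (3 + a - b) M))).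
    - intros M. unfold k. rewrite kummer_shift_a. unfold kterm. rewrite poch_S. field.
      apply RtoC_fact_neq_0.
    - apply (Ccv_eq _ ((b - 1) * 0)); [ | ring ]. apply Ccv_scal.
      destruct (kterm_bound (a + 1) b (3 + a - b) Hb) as [D [HD0 HD]]; [ unfold Re in *; simpl; lra | ].
      apply (Ccv_0_bound _ (fun n => (Cmod b + 1) * D * / INR (S n))%R).
      + exists O; intros n _. rewrite Cmod_mult.
        assert (Hn : (0 <= INR n)%R) by apply pos_INR.
        assert (H1 : (Cmod (b + RtoC (INR n)) <= (Cmod b + 1) * INR (S (S n)))%R).
        { eapply Rle_trans; [ apply Cmod_triangle | ].
          rewrite Cmod_R, Rabs_pos_eq, !S_INR by auto. generalize (Cmod_ge_0 b); nra. }
        eapply Rle_trans; [ apply Rmult_le_compat; [ apply Cmod_ge_0 | apply Cmod_ge_0 | exact H1 | apply HD ] | ].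
        right. rewrite !S_INR. field. lra.
      + replace (Finite 0) with (Finite ((Cmod b + 1) * D * 0)) by (f_equal; ring).
        apply is_lim_seq_mult'; [ apply is_lim_seq_const | apply is_lim_seq_inv_S ]. }
  assert (H' : Ccv (fun M => csum (kterm a b (1 + a - b)) (S M)
                - k * csum (kterm (a + 2) b (1 + (a + 2) - b)) (S M)) (Ksum a b - k * Ksum (a + 2) b)).
  { apply Ccv_minus; [ | apply Ccv_scal ];
      [ apply (Ccv_incr (csum (kterm a b (1 + a - b))))
      | apply (Ccv_incr (csum (kterm (a + 2) b (1 + (a + 2) - b)))) ]; now apply Ksum_cv. }
  assert (E := Ccv_unique _ _ _ H' H).
  replace (Ksum a b) with (Ksum a b - k * Ksum (a + 2) b + k * Ksum (a + 2) b) by ring.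
  rewrite E; ring.
Qed.

(** Sum and closed form obey the same recurrence; cross-multiplication keeps the identity valid
    where its coefficient or [Kvalue] vanishes. *)
Lemma Ksum_Kvalue_cross (b : C) (n : nat) : (Re b <= -1)%R -> forall a,
  Ksum a b * Kvalue (a + RtoC (INR (2 * n))) b = Kvalue a b * Ksum (a + RtoC (INR (2 * n))) b.
Proof.
  intros Hb; induction n as [ | n IH ]; intros a.
  - simpl. rewrite Cplus_0_r. ring.
  - replace (2 * S n)%nat with (S (S (2 * n))) by lia. rewrite !RtoC_INR_S.
    replace (a + (RtoC (INR (2 * n)) + 1 + 1)) with (a + 2 + RtoC (INR (2 * n))) by ring.
    rewrite (Ksum_shift_a a b Hb), (Kvalue_shift_a a b).
    rewrite <- Cmult_assoc, IH. ring.
Qed.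

Lemma Kvalue_ratio_cv (a b : C) :
  Ccv (fun n => Kvalue (a + RtoC (INR (2 * n))) b / rGamma (1 + (a + RtoC (INR (2 * n))) - b))
      (cpow_pos 2 (- b)).
Proof.
  apply Ccv_incr.
  set (A1 := (a + 1) / 2). set (A2 := 1 + a / 2 - b).
  set (A3 := (1 + a - b) / 2). set (A4 := A3 + 1 / 2).
  set (s := fun z n => rGamma (z + RtoC (INR (S n))) * RtoC (INR (fact n)) * cpow_pos (INR n) z).
  assert (Hs : forall z, Ccv (s z) 1) by (intros z; apply rGamma_asymptotic).
  apply (Ccv_ext_loc (fun n => cpow_pos 2 (- b) * ((s A1 n * s A2 n) / (s A3 n * s A4 n)))).
  - destruct (Ccv_nonzero_eventually _ _ C1_nz (Hs A3)) as [N3 H3].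
    destruct (Ccv_nonzero_eventually _ _ C1_nz (Hs A4)) as [N4 H4].
    exists (N3 + N4)%nat; intros n Hn. specialize (H3 n ltac:(lia)). specialize (H4 n ltac:(lia)).
    unfold s in *.
    assert (R3 : rGamma (A3 + RtoC (INR (S n))) <> 0) by (intros E; apply H3; rewrite E; ring).
    assert (R4 : rGamma (A4 + RtoC (INR (S n))) <> 0) by (intros E; apply H4; rewrite E; ring).
    assert (E2 : RtoC (INR (2 * S n)) = 2 * RtoC (INR (S n))) by (now rewrite mult_INR, RtoC_mult).
    set (x := RtoC (INR (S n))) in *. rewrite E2.
    assert (ED := rGamma_duplication (A3 + x)).
    replace (2 * (A3 + x)) with (1 + (a + 2 * x) - b) in ED by (unfold A3; field).
    replace (A3 + x + 1 / 2) with (A4 + x) in ED by (unfold A4; ring).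
    unfold Kvalue.
    replace ((a + 2 * x + 1) / 2) with (A1 + x) by (unfold A1; field).
    replace (1 + (a + 2 * x) / 2 - b) with (A2 + x) by (unfold A2; field).
    replace (rGamma (1 + (a + 2 * x) - b))
      with (cpow_pos 2 (1 - (1 + (a + 2 * x) - b)) * rGamma (A3 + x) * rGamma (A4 + x) / rGamma (1 / 2)).
    2:{ rewrite <- ED. field. apply rGamma_half_neq_0. }
    replace (1 - (1 + (a + 2 * x) - b)) with (- (a + 2 * x) + b) by ring.
    rewrite (cpow_pos_plus 2 (- (a + 2 * x)) b), (cpow_pos_opp 2 b).
    (* After duplication the four arguments are balanced, [A1 + A2 = A3 + A4], so the powers of [n]
       cancel. *)
    assert (EP : cpow_pos (INR n) A1 * cpow_pos (INR n) A2 = cpow_pos (INR n) A3 * cpow_pos (INR n) A4).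
    { rewrite <- !cpow_pos_plus. f_equal. unfold A4, A3, A2, A1. field. }
    transitivity (/ cpow_pos 2 b * (rGamma (A1 + x) * rGamma (A2 + x)) / (rGamma (A3 + x) * rGamma (A4 + x))
       * ((cpow_pos (INR n) A1 * cpow_pos (INR n) A2) / (cpow_pos (INR n) A3 * cpow_pos (INR n) A4))).
    + field. repeat split; auto using cpow_pos_neq_0, RtoC_fact_neq_0.
    + rewrite EP. field. repeat split; auto using cpow_pos_neq_0, rGamma_half_neq_0.
  - apply (Ccv_eq _ (cpow_pos 2 (- b) * ((1 * 1) / (1 * 1)))); [ | field ].
    apply Ccv_scal, Ccv_div; [ rewrite Cmult_1_l; apply C1_nz | | ]; apply Ccv_mult; apply Hs.
Qed.

(* Unregularised term, available once [c = 1 + a - b] is not a pole. *)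
Definition hterm (a b : C) (n : nat) : C :=
  (-1) ^ n * (poch a n / poch (1 + a - b) n) * (poch b n / RtoC (INR (fact n))).

(** Factor by factor [|a + k| <= |1 + a - b + k|]: the real part grows by [1 - Re b >= 2], and the
    gain [4 Re a] in the square outweighs the cross term [2 Im a Im b]. *)
Lemma poch_ratio_bound (a b : C) :
  (Re b <= -1)%R -> (Rabs (Im a * Im b) <= Re a)%R ->
  forall n, (Cmod (poch a n / poch (1 + a - b) n) <= 1)%R.
Proof.
  intros Hb Ha.
  assert (Ha0 : (0 <= Re a)%R) by (generalize (Rabs_pos (Im a * Im b)); lra).
  assert (Hc : ~ nonpos_int (1 + a - b)) by (apply not_nonpos_int_Re; unfold Re in *; simpl; lra).
  assert (Hk : forall k, (Cmod (a + RtoC (INR k)) <= Cmod (1 + a - b + RtoC (INR k)))%R).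
  { intros k. unfold Cmod. apply sqrt_le_1_alt. destruct a as [a1 a2], b as [b1 b2]. unfold Re, Im in *; simpl in *.
    assert (Hk := pos_INR k). set (x := INR k) in *.
    apply Rabs_le_between in Ha. nra. }
  induction n as [ | n IH ].
  - unfold poch; simpl. replace (1 / 1) with (RtoC 1) by field. rewrite Cmod_1; lra.
  - rewrite !poch_S.
    assert (Hn := nonpos_int_neq_0 _ n Hc). assert (Hp := poch_neq_0 _ n Hc).
    replace (poch a n * (a + RtoC (INR n)) / (poch (1 + a - b) n * (1 + a - b + RtoC (INR n))))
      with ((poch a n / poch (1 + a - b) n) * ((a + RtoC (INR n)) / (1 + a - b + RtoC (INR n))))
      by (field; auto).
    rewrite Cmod_mult. apply Rle_trans with (1 * 1)%R; [ | lra ].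
    apply Rmult_le_compat; auto using Cmod_ge_0.
    rewrite Cmod_div by auto. apply Cmod_gt_0 in Hn.
    apply Rmult_le_reg_r with (Cmod (1 + a - b + RtoC (INR n))); auto.
    unfold Rdiv. rewrite Rmult_assoc, Rinv_l, Rmult_1_r, Rmult_1_l by lra. apply Hk.
Qed.

(** The domination half of the limit exchange: the tail of the unregularised series is bounded
    independently of [a]. *)
Lemma hterm_sum (a b : C) (D : R) :
  (Re b <= -1)%R -> (Rabs (Im a * Im b) <= Re a)%R -> (0 <= D)%R ->
  (forall n, (Cmod (poch b n / RtoC (INR (fact n))) <= D * (/ INR (S n) - / INR (S (S n))))%R) ->
  forall n, (Cmod (Ksum a b / rGamma (1 + a - b) - csum (hterm a b) n) <= D * / INR (S n))%R.
Proof.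
  intros Hb Ha HD0 HD.
  assert (Ha0 : (0 <= Re a)%R) by (generalize (Rabs_pos (Im a * Im b)); lra).
  assert (Hc : ~ nonpos_int (1 + a - b)) by (apply not_nonpos_int_Re; unfold Re in *; simpl; lra).
  destruct (csum_cv_dominated (hterm a b) D HD0) as [l [Hl Hb']].
  { intros n. unfold hterm. rewrite !Cmod_mult, Cmod_pow_m1, Rmult_1_l, <- (Rmult_1_l (D * _)).
    apply Rmult_le_compat; auto using Cmod_ge_0. now apply poch_ratio_bound. }
  replace (Ksum a b / rGamma (1 + a - b)) with l; auto.
  apply (Ccv_unique (csum (hterm a b))); auto.
  apply (Ccv_ext (fun n => csum (kterm a b (1 + a - b)) n / rGamma (1 + a - b))).
  - induction n as [ | n IH ]; [ simpl; field; now apply rGamma_neq_0 | ].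
    rewrite !csum_S, <- IH. unfold kterm, hterm.
    assert (Hr := rGamma_neq_0 _ (not_nonpos_int_plus _ n Hc)).
    rewrite (rGamma_poch (1 + a - b) n). field. repeat split; auto using poch_neq_0, RtoC_fact_neq_0.
  - apply Ccv_div; auto using rGamma_neq_0, Ksum_cv, Ccv_const.
Qed.

Lemma csum_hterm_cv (a b : C) (N : nat) :
  Ccv (fun n => csum (hterm (a + RtoC (INR (2 * n))) b) N)
      (csum (fun k => (-1) ^ k * (poch b k / RtoC (INR (fact k)))) N).
Proof.
  assert (HP : forall k, Ccv (fun n => poch (a + RtoC (INR (2 * n))) k
        / poch (1 + (a + RtoC (INR (2 * n))) - b) k) 1).
  { induction k as [ | k IH ].
    - apply (Ccv_ext (fun _ => 1)); [ intros; unfold poch; simpl; field | apply Ccv_const ].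
    - apply (Ccv_ext (fun n => poch (a + RtoC (INR (2 * n))) k / poch (1 + (a + RtoC (INR (2 * n))) - b) k
        * ((a + RtoC (INR k) + RtoC (INR (2 * n))) / (1 + a - b + RtoC (INR k) + RtoC (INR (2 * n)))))).
      + intros n. rewrite !poch_S. unfold Cdiv.
        replace (1 + (a + RtoC (INR (2 * n))) - b + RtoC (INR k))
          with (1 + a - b + RtoC (INR k) + RtoC (INR (2 * n))) by ring.
        replace (a + RtoC (INR (2 * n)) + RtoC (INR k))
          with (a + RtoC (INR k) + RtoC (INR (2 * n))) by ring.
        (* [Cinv_mult] covers zero factors through [/ 0 = 0], so the equality holds even for those
           [n] at which the denominator vanishes. *)
        rewrite Cinv_mult. ring.
      + apply (Ccv_eq _ (1 * 1)); [ | ring ]. apply Ccv_mult; auto. apply Ccv_ratio_affine; lia. }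
  induction N as [ | N IH ]; [ apply Ccv_const | ].
  simpl. apply Ccv_plus; auto. unfold hterm.
  apply (Ccv_eq _ ((-1) ^ N * 1 * (poch b N / RtoC (INR (fact N))))); [ | ring ].
  apply Ccv_mult; [ apply Ccv_scal, HP | apply Ccv_const ].
Qed.

Lemma Ksum_0 (b : C) : Ksum 0 b = rGamma (1 - b).
Proof.
  apply Clim_unique, Ccv_incr.
  apply (Ccv_ext (fun _ => rGamma (1 - b))); [ | apply Ccv_const ].
  induction n as [ | n IH ].
  - simpl. rewrite kterm_0. replace (1 + 0 - b) with (1 - b) by ring. ring.
  - rewrite csum_S, <- IH. unfold kterm. rewrite (poch_S_l 0). field. apply RtoC_fact_neq_0.
Qed.

Lemma Kvalue_0 (b : C) : Kvalue 0 b = rGamma (1 - b).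
Proof.
  unfold Kvalue. replace (- 0) with (RtoC 0) by ring. rewrite cpow_pos_0.
  replace ((0 + 1) / 2) with (1 / 2) by field. replace (1 + 0 / 2 - b) with (1 - b) by field.
  field. apply rGamma_half_neq_0.
Qed.

(** An [eps / 3] argument. For fixed [N] both partial sums tend to the same binomial sum [l], and
    only this coincidence matters, so [l] need not be evaluated. *)
Lemma Ksum_ratio_diff_cv (a b : C) :
  (Re b <= -1)%R ->
  Ccv (fun n => Ksum (a + RtoC (INR (2 * n))) b / rGamma (1 + (a + RtoC (INR (2 * n))) - b)
              - Ksum (0 + RtoC (INR (2 * n))) b / rGamma (1 + (0 + RtoC (INR (2 * n))) - b)) 0.
Proof.
  intros Hb. destruct (binomial_coeff_bound b Hb) as [D [HD0 HD]].
  assert (HT : forall a', eventually (fun n => forall N,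
     (Cmod (Ksum (a' + RtoC (INR (2 * n))) b / rGamma (1 + (a' + RtoC (INR (2 * n))) - b)
        - csum (hterm (a' + RtoC (INR (2 * n))) b) N) <= D * / INR (S N))%R)).
  { intros a'. destruct (INR_unbounded (Rabs (Im a' * Im b) - Re a')) as [n0 Hn0].
    exists n0; intros n Hn N. apply hterm_sum; auto. simpl.
    assert (INR n0 <= INR (2 * n))%R by (apply le_INR; lia).
    simpl in H. unfold Re, Im in *. rewrite Rplus_0_r. lra. }
  apply Ccv_Cmod, is_lim_seq_spec. intros eps.
  assert (He := cond_pos eps).
  assert (HL : is_lim_seq (fun n => (D * / INR (S n))%R) 0%R).
  { replace (Finite 0) with (Finite (D * 0)) by (f_equal; ring).
    apply is_lim_seq_mult'; [ apply is_lim_seq_const | apply is_lim_seq_inv_S ]. }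
  apply is_lim_seq_spec in HL. destruct (HL (mkposreal (eps / 3) ltac:(lra))) as [N HN].
  specialize (HN N (Nat.le_refl N)); simpl pos in HN. rewrite Rminus_0_r in HN.
  apply Rabs_def2 in HN.
  assert (HS := Ccv_minus _ _ _ _ (csum_hterm_cv a b N) (csum_hterm_cv 0 b N)).
  apply Ccv_Cmod, is_lim_seq_spec in HS. destruct (HS (mkposreal (eps / 3) ltac:(lra))) as [n1 Hn1].
  destruct (HT a) as [n2 Hn2]. destruct (HT 0) as [n3 Hn3].
  exists (n1 + n2 + n3)%nat; intros n Hn.
  specialize (Hn1 n ltac:(lia)). specialize (Hn2 n ltac:(lia) N). specialize (Hn3 n ltac:(lia) N).
  simpl pos in Hn1. rewrite Rminus_0_r in *. rewrite Rabs_pos_eq in * by apply Cmod_ge_0.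
  set (x := _ / _) in Hn2. set (y := _ / _) in Hn3.
  set (p := csum (hterm (a + _) b) N) in *. set (q := csum (hterm (0 + _) b) N) in *.
  set (l := csum _ N) in Hn1.
  fold x y.
  replace (x - y - 0) with ((x - p) + ((p - q - (l - l)) + - (y - q))) by ring.
  eapply Rle_lt_trans; [ apply Cmod_triangle | ].
  eapply Rle_lt_trans; [ apply Rplus_le_compat_l, Cmod_triangle | ].
  rewrite Cmod_opp. lra.
Qed.

Lemma Ksum_value (a b : C) : (Re b <= -1)%R -> Ksum a b = Kvalue a b.
Proof.
  intros Hb.
  set (r := fun a n => rGamma (1 + (a + RtoC (INR (2 * n))) - b)).
  assert (Hr0 : rGamma (1 - b) <> 0).
  { apply rGamma_neq_0, not_nonpos_int_Re. unfold Re in *; simpl. lra. }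
  (* At [a = 0] sum and closed form both equal [rGamma (1 - b)], which is nonzero; cancelling it in
     the cross identity makes them agree at every [2 n]. *)
  assert (H0 : Ccv (fun n => Ksum (0 + RtoC (INR (2 * n))) b / r 0 n) (cpow_pos 2 (- b))).
  { apply (Ccv_ext (fun n => Kvalue (0 + RtoC (INR (2 * n))) b / r 0 n)); [ | apply Kvalue_ratio_cv ].
    intros n. f_equal. assert (E := Ksum_Kvalue_cross b n Hb 0).
    rewrite Ksum_0, Kvalue_0 in E.
    transitivity (rGamma (1 - b) * Kvalue (0 + RtoC (INR (2 * n))) b / rGamma (1 - b)); [ now field | ].
    rewrite E. now field. }
  assert (Ha : Ccv (fun n => Ksum (a + RtoC (INR (2 * n))) b / r a n) (cpow_pos 2 (- b))).
  { apply (Ccv_ext (fun n => (Ksum (a + RtoC (INR (2 * n))) b / r a n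
        - Ksum (0 + RtoC (INR (2 * n))) b / r 0 n) + Ksum (0 + RtoC (INR (2 * n))) b / r 0 n));
      [ intros; ring | ].
    apply (Ccv_eq _ (0 + cpow_pos 2 (- b))); [ | ring ].
    apply Ccv_plus; [ now apply Ksum_ratio_diff_cv | exact H0 ]. }
  assert (H1 := Ccv_scal (Kvalue a b) _ _ Ha).
  assert (H2 := Ccv_scal (Ksum a b) _ _ (Kvalue_ratio_cv a b)).
  (* The cross identity divided by [rGamma (1 + a + 2 n - b)], in the limit; both quotients tend to
     the nonzero [2^(-b)]. *)
  assert (E : Ksum a b * cpow_pos 2 (- b) = Kvalue a b * cpow_pos 2 (- b)).
  { apply (Ccv_unique _ _ _ H2). revert H1. apply Ccv_ext. intros n. fold (r a n).
    unfold Cdiv. rewrite !Cmult_assoc. f_equal. symmetry. now apply Ksum_Kvalue_cross. }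
  transitivity (Ksum a b * cpow_pos 2 (- b) / cpow_pos 2 (- b)); [ field; apply cpow_pos_neq_0 | ].
  rewrite E. field. apply cpow_pos_neq_0.
Qed.

(** [m] counts the shifts needed to reach absolute convergence. Lowering [b] also raises
    [1 + a - b], so each shift shrinks the terms by a factor of order [1/n^2] and preserves the null
    hypothesis. *)
Lemma kummer_shifted (m : nat) : forall a b : C,
  (Re b - INR m <= -1)%R -> Ccv (kterm a b (1 + a - b)) 0 ->
  Ccv (csum (kterm a b (1 + a - b))) (Kvalue a b).
Proof.
  induction m as [ | m IH ]; intros a b Hb Hu.
  - simpl in Hb. rewrite <- Ksum_value; [ apply Ksum_cv | ]; lra.
  - apply Ccv_incr. rewrite S_INR in Hb.
    assert (Hv : Ccv (kterm a (b - 1) (1 + a - (b - 1))) 0).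
    { apply (Ccv_0_affine (kterm a (b - 1) (1 + a - b)) _ (1 + a - b) 1).
      - apply (Ccv_0_affine _ _ (b - 1) (b - 1) Hu). intros n.
        rewrite kterm_S_b. now replace (b - 1 + 1) with b by ring.
      - intros n. replace (1 + a - (b - 1)) with (1 + a - b + 1) by ring.
        rewrite kterm_S_c. ring. }
    assert (HI : Ccv (csum (kterm a (b - 1) (1 + a - (b - 1)))) (Kvalue a (b - 1))).
    { apply IH; auto. unfold Re in *; simpl. lra. }
    apply (proj1 (Ccv_incr _ _)) in HI.
    apply (Ccv_ext (fun M => (1 + a / 2 - b) * csum (kterm a (b - 1) (1 + a - (b - 1))) (S M)
       + 1 / 2 * (-1) ^ M * poch a (S M) * poch b M * rGamma (2 + a - b + RtoC (INR M)) / RtoC (INR (fact M)))).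
    { intros M. rewrite <- kummer_shift_b. ring. }
    apply (Ccv_eq _ ((1 + a / 2 - b) * Kvalue a (b - 1) + 0)); [ | rewrite <- Kvalue_shift_b; ring ].
    apply Ccv_plus; [ now apply Ccv_scal | ].
    apply (Ccv_0_affine_ratio (fun M => kterm a b (1 + a - b) (S M)) _ b 1 (- (1 / 2))).
    + now apply (proj1 (Ccv_incr _ _)) in Hu.
    + intros M. unfold kterm. rewrite (poch_S b M), Cpow_S, RtoC_fact_S, RtoC_INR_S.
      replace (1 + a - b + (RtoC (INR M) + 1)) with (2 + a - b + RtoC (INR M)) by ring.
      field. split; [ apply RtoC_fact_neq_0 | ].
      rewrite <- RtoC_INR_S. apply RtoC_INR_neq_0; lia.
Qed.

Lemma kummer (a b : C) :
  Ccv (kterm a b (1 + a - b)) 0 -> Ccv (csum (kterm a b (1 + a - b))) (Kvalue a b).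
Proof.
  destruct (INR_unbounded (Re b + 1)) as [m Hm]. apply (kummer_shifted m). lra.
Qed.

(** Duplication at [(a + 1) / 2 - b] turns Kummer's value into the [i = 0] case of the theorem's
    right-hand side; the division by [rGamma] there requires the hypothesis. *)
Lemma Kvalue_Gamma (a b : C) :
  ~ nonpos_int ((a + 1) / 2 - b) ->
  Kvalue a b = cpow_pos 2 (- (2 * b)) * rGamma (1 + a - 2 * b)
                 * (rGamma ((a + 1) / 2) / rGamma ((a + 1) / 2 - b)).
Proof.
  intros H. apply rGamma_neq_0 in H.
  assert (ED := rGamma_duplication ((a + 1) / 2 - b)).
  replace (2 * ((a + 1) / 2 - b)) with (1 + a - 2 * b) in ED by field.
  replace ((a + 1) / 2 - b + 1 / 2) with (1 + a / 2 - b) in ED by field.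
  replace (1 - (1 + a - 2 * b)) with (- a + 2 * b) in ED by ring.
  unfold Kvalue.
  transitivity (cpow_pos 2 (- (2 * b)) * (cpow_pos 2 (- a + 2 * b) * rGamma ((a + 1) / 2 - b) * rGamma (1 + a / 2 - b))
      * rGamma ((a + 1) / 2) / rGamma ((a + 1) / 2 - b) / rGamma (1 / 2)).
  - rewrite cpow_pos_plus, (cpow_pos_opp 2 (2 * b)).
    field. auto using cpow_pos_neq_0, rGamma_half_neq_0.
  - rewrite <- ED. field. auto using rGamma_half_neq_0.
Qed.

(** * Reduction of the double series *)

Lemma csum_ext (f g : nat -> C) (n : nat) :
  (forall k, (k < n)%nat -> f k = g k) -> csum f n = csum g n.
Proof.
  induction n as [ | n IH ]; intros H; [ reflexivity | ].
  rewrite !csum_S, IH, H; auto.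
Qed.

Lemma csum_scal (c : C) (f : nat -> C) (n : nat) : csum (fun k => c * f k) n = c * csum f n.
Proof. induction n as [ | n IH ]; simpl; [ ring | rewrite IH; ring ]. Qed.

(** * Pascal's rule for the finite Gamma sums and induction on [i] *)

Lemma cbinom_0 (n : nat) : cbinom n 0 = 1.
Proof. unfold cbinom. now rewrite C_n_0. Qed.

Lemma cbinom_diag (n : nat) : cbinom n n = 1.
Proof. unfold cbinom. now rewrite C_n_n. Qed.

Lemma csum_pascal (f : nat -> C) (i : nat) :
  csum (fun r => cbinom (S i) r * f r) (S (S i))
  = csum (fun r => cbinom i r * f r) (S i) + csum (fun r => cbinom i r * f (S r)) (S i).
Proof.
  (* [Binomial.C i (i + 1)] is [1 / (i + 1)], not 0, because natural subtraction truncates; so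
     Pascal's rule is kept below the top index and the last term is added separately. *)
  assert (H : forall k, (k <= i)%nat -> csum (fun r => cbinom (S i) r * f r) (S k)
     = csum (fun r => cbinom i r * f r) (S k) + csum (fun r => cbinom i r * f (S r)) k).
  { induction k as [ | k IH ]; intros Hk.
    - simpl. rewrite !cbinom_0. ring.
    - rewrite (csum_S _ (S k)), IH by lia.
      rewrite (csum_S (fun r => cbinom i r * f r) (S k)), (csum_S (fun r => cbinom i r * f (S r)) k).
      assert (E : cbinom (S i) (S k) = cbinom i k + cbinom i (S k)).
      { unfold cbinom. rewrite <- RtoC_plus, pascal by lia. reflexivity. }
      rewrite E. ring. }
  rewrite (csum_S _ (S i)), (H i) by lia. rewrite (csum_S (fun r => cbinom i r * f (S r)) i).
  rewrite !cbinom_diag. ring.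
Qed.

(** Common to both identities: [e = -1], [g = gamma - i] for the first and [e = 1], [g = gamma] for
    the second. Each quotient is [Gamma(x - g) / Gamma(x)]. *)
Definition gamma_sum (e : C) (i : nat) (a g : C) : C :=
  csum (fun r => cbinom i r * (e ^ r * (rGamma ((a - RtoC (INR i) + RtoC (INR r) + 1) / 2)
     / rGamma ((a - RtoC (INR i) + RtoC (INR r) + 1) / 2 - g)))) (S i).

Lemma gamma_sum_S (e : C) (i : nat) (a g : C) :
  gamma_sum e (S i) a g = gamma_sum e i (a - 1) g + e * gamma_sum e i a g.
Proof.
  unfold gamma_sum.
  rewrite (csum_pascal (fun r => e ^ r * (rGamma ((a - RtoC (INR (S i)) + RtoC (INR r) + 1) / 2)
     / rGamma ((a - RtoC (INR (S i)) + RtoC (INR r) + 1) / 2 - g)))).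
  rewrite <- csum_scal. f_equal; apply csum_ext; intros k _.
  - rewrite RtoC_INR_S.
    now replace (a - (RtoC (INR i) + 1) + RtoC (INR k) + 1)
      with (a - 1 - RtoC (INR i) + RtoC (INR k) + 1) by ring.
  - rewrite Cpow_S, !RtoC_INR_S.
    replace (a - (RtoC (INR i) + 1) + (RtoC (INR k) + 1) + 1)
      with (a - RtoC (INR i) + RtoC (INR k) + 1) by ring.
    unfold Cdiv. ring.
Qed.

Lemma cpow_pos_2_S (z : C) : cpow_pos 2 (z - 1) = cpow_pos 2 z / 2.
Proof. rewrite cpow_pos_minus, cpow_pos_1 by lra. reflexivity. Qed.

(** [contiguous_c] reduces level [i + 1] at [a] to level [i] at [a - 1] and at [a], exactly as
    [gamma_sum_S] does. Its factor [1/2] builds [2^(-i)], and its coefficient [c - g] is what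
    [rGamma_S] needs to give both parts the same prefactor. *)
Lemma kummer_minus (i : nat) : forall a g : C,
  (forall r, (r <= i)%nat -> ~ nonpos_int ((a - RtoC (INR i) + RtoC (INR r) + 1) / 2 - g)) ->
  Ccv (kterm a g (1 + a - g - RtoC (INR i))) 0 ->
  Ccv (csum (kterm a g (1 + a - g - RtoC (INR i))))
    (cpow_pos 2 (- RtoC (INR i) - 2 * g) * rGamma (1 + a - 2 * g - RtoC (INR i)) * gamma_sum 1 i a g).
Proof.
  induction i as [ | i IH ]; intros a g Hp Hu.
  - specialize (Hp O (Nat.le_refl _)). simpl INR in *.
    replace (a - 0 + 0 + 1) with (a + 1) in Hp by ring.
    replace (1 + a - g - 0) with (1 + a - g) in * by ring.
    apply (Ccv_eq _ _ _ (kummer a g Hu)). rewrite Kvalue_Gamma by exact Hp.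
    unfold gamma_sum. simpl. rewrite cbinom_0.
    replace (a - 0 + 0 + 1) with (a + 1) by ring.
    replace (- 0 - 2 * g) with (- (2 * g)) by ring.
    replace (1 + a - 2 * g - 0) with (1 + a - 2 * g) by ring. ring.
  - set (c := 1 + a - g - RtoC (INR (S i))) in *.
    assert (Ec : 1 + (a - 1) - g - RtoC (INR i) = c) by (unfold c; rewrite RtoC_INR_S; ring).
    assert (Ec' : 1 + a - g - RtoC (INR i) = c + 1) by (unfold c; rewrite RtoC_INR_S; ring).
    assert (Hu1 : Ccv (kterm (a - 1) g c) 0).
    { apply (Ccv_0_affine _ _ (a - 1) (a - 1) Hu). intros n; apply kterm_S_a. }
    assert (Hu2 : Ccv (kterm a g (c + 1)) 0).
    { apply (Ccv_0_affine _ _ c 1 Hu). intros n; rewrite kterm_S_c; ring. }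
    assert (H1 := IH (a - 1) g). assert (H2 := IH a g). clear IH.
    rewrite Ec in H1. rewrite Ec' in H2.
    assert (H1' := fun P => H1 P Hu1). assert (H2' := fun P => H2 P Hu2). clear H1 H2.
    assert (H1 := H1' ltac:(intros r Hr; specialize (Hp r ltac:(lia)); rewrite RtoC_INR_S in Hp;
      now replace (a - 1 - RtoC (INR i) + RtoC (INR r) + 1)
        with (a - (RtoC (INR i) + 1) + RtoC (INR r) + 1) by ring)).
    assert (H2 := H2' ltac:(intros r Hr; specialize (Hp (S r) ltac:(lia)); rewrite !RtoC_INR_S in Hp;
      now replace (a - RtoC (INR i) + RtoC (INR r) + 1)
        with (a - (RtoC (INR i) + 1) + (RtoC (INR r) + 1) + 1) by ring)).
    clear H1' H2'.
    apply (proj1 (Ccv_incr _ _)) in H1. apply (proj1 (Ccv_incr _ _)) in H2.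
    apply Ccv_incr.
    apply (Ccv_ext (fun M => 1 / 2 * (csum (kterm (a - 1) g c) (S M)
       + (c - g) * csum (kterm a g (c + 1)) (S M) + (kterm a g c M - (c - g) * kterm a g (c + 1) M)))).
    { intros M. rewrite <- contiguous_c. field. }
    eapply Ccv_eq.
    + apply Ccv_scal, Ccv_plus; [ apply Ccv_plus; [ exact H1 | apply Ccv_scal, H2 ] | ].
      apply Ccv_minus; [ exact Hu | apply Ccv_scal, Hu2 ].
    + rewrite gamma_sum_S, RtoC_INR_S.
      replace (- (RtoC (INR i) + 1) - 2 * g) with (- RtoC (INR i) - 2 * g - 1) by ring.
      rewrite cpow_pos_2_S.
      replace (1 + (a - 1) - 2 * g - RtoC (INR i)) with (a - 2 * g - RtoC (INR i)) by ring.
      replace (1 + a - 2 * g - (RtoC (INR i) + 1)) with (a - 2 * g - RtoC (INR i)) by ring.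
      rewrite (rGamma_S (a - 2 * g - RtoC (INR i))).
      replace (a - 2 * g - RtoC (INR i) + 1) with (1 + a - 2 * g - RtoC (INR i)) by ring.
      replace (c - g) with (a - 2 * g - RtoC (INR i)) by (unfold c; rewrite RtoC_INR_S; ring).
      field.
Qed.

(** The same scheme with [contiguous_b] and [g] held fixed. Its leading coefficient [b = g + i]
    extends [poch g i] by one factor at each step; keeping that product on the left avoids any
    division during the induction. *)
Lemma kummer_plus (i : nat) : forall a g : C,
  (forall r, (r <= i)%nat -> ~ nonpos_int ((a - RtoC (INR i) + RtoC (INR r) + 1) / 2 - g)) ->
  Ccv (kterm a (g + RtoC (INR i)) (1 + a - g)) 0 ->
  Ccv (fun M => poch g i * csum (kterm a (g + RtoC (INR i)) (1 + a - g)) M)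
    (cpow_pos 2 (- RtoC (INR i) - 2 * g) * rGamma (1 + a - 2 * g - RtoC (INR i)) * gamma_sum (-1) i a g).
Proof.
  induction i as [ | i IH ]; intros a g Hp Hu.
  - specialize (Hp O (Nat.le_refl _)). simpl INR in *.
    replace (a - 0 + 0 + 1) with (a + 1) in Hp by ring.
    replace (g + 0) with g in * by ring.
    apply (Ccv_eq _ (poch g 0 * Kvalue a g)); [ apply Ccv_scal, kummer, Hu | ].
    rewrite Kvalue_Gamma by exact Hp.
    unfold gamma_sum, poch. simpl. rewrite cbinom_0.
    replace (a - 0 + 0 + 1) with (a + 1) by ring.
    replace (- 0 - 2 * g) with (- (2 * g)) by ring.
    replace (1 + a - 2 * g - 0) with (1 + a - 2 * g) by ring. ring.
  - set (c := 1 + a - g) in *. set (b := g + RtoC (INR i)).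
    replace (g + RtoC (INR (S i))) with (b + 1) in * by (unfold b; rewrite RtoC_INR_S; ring).
    assert (Ec : 1 + (a - 1) - g = c - 1) by (unfold c; ring).
    assert (Hu2 : Ccv (kterm a b c) 0).
    { apply (Ccv_0_affine _ _ b b Hu). intros n; apply kterm_S_b. }
    assert (Hu1 : Ccv (kterm (a - 1) b (c - 1)) 0).
    { apply (Ccv_0_affine_ratio _ _ (a - 1) (c - 1) (a - 1) Hu2). intros n.
      rewrite kterm_S_a, <- (kterm_S_c a b (c - 1)). now replace (c - 1 + 1) with c by ring. }
    assert (H1 := IH (a - 1) g). assert (H2 := IH a g). clear IH.
    fold b in H1, H2. fold c in H2. rewrite Ec in H1.
    assert (H1' := fun P => H1 P Hu1). assert (H2' := fun P => H2 P Hu2). clear H1 H2.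
    assert (H1 := H1' ltac:(intros r Hr; specialize (Hp r ltac:(lia)); rewrite RtoC_INR_S in Hp;
      now replace (a - 1 - RtoC (INR i) + RtoC (INR r) + 1)
        with (a - (RtoC (INR i) + 1) + RtoC (INR r) + 1) by ring)).
    assert (H2 := H2' ltac:(intros r Hr; specialize (Hp (S r) ltac:(lia)); rewrite !RtoC_INR_S in Hp;
      now replace (a - RtoC (INR i) + RtoC (INR r) + 1)
        with (a - (RtoC (INR i) + 1) + (RtoC (INR r) + 1) + 1) by ring)).
    clear H1' H2'.
    apply (proj1 (Ccv_incr _ _)) in H1. apply (proj1 (Ccv_incr _ _)) in H2.
    apply Ccv_incr.
    apply (Ccv_ext (fun M => 1 / 2 * (poch g i * csum (kterm (a - 1) b (c - 1)) (S M)
       - (c - 1 - b) * (poch g i * csum (kterm a b c) (S M)) + poch g i * b * kterm a (b + 1) c M))).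
    { intros M. rewrite poch_S. fold b.
      transitivity (1 / 2 * poch g i * (csum (kterm (a - 1) b (c - 1)) (S M)
         - (c - 1 - b) * csum (kterm a b c) (S M) + b * kterm a (b + 1) c M)); [ ring | ].
      rewrite <- contiguous_b. field. }
    eapply Ccv_eq.
    + apply Ccv_scal, Ccv_plus; [ apply Ccv_minus; [ exact H1 | apply Ccv_scal, H2 ] | ].
      apply Ccv_scal, Hu.
    + rewrite gamma_sum_S, RtoC_INR_S.
      replace (- (RtoC (INR i) + 1) - 2 * g) with (- RtoC (INR i) - 2 * g - 1) by ring.
      rewrite cpow_pos_2_S.
      replace (1 + (a - 1) - 2 * g - RtoC (INR i)) with (a - 2 * g - RtoC (INR i)) by ring.
      replace (1 + a - 2 * g - (RtoC (INR i) + 1)) with (a - 2 * g - RtoC (INR i)) by ring.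
      rewrite (rGamma_S (a - 2 * g - RtoC (INR i))).
      replace (a - 2 * g - RtoC (INR i) + 1) with (1 + a - 2 * g - RtoC (INR i)) by ring.
      replace (c - 1 - b) with (a - 2 * g - RtoC (INR i)) by (unfold b, c; ring).
      field.
Qed.

(** * Chu-Vandermonde summation along the diagonals *)

Lemma chu_vandermonde (N : nat) : forall b d : C, ~ nonpos_int d ->
  csum (fun m => cbinom N m * ((-1) ^ m * (poch b (N - m) / poch d (N - m)))) (S N)
  = (-1) ^ N * poch (d - b) N / poch d N.
Proof.
  induction N as [ | N IH ]; intros b d Hd.
  - simpl. rewrite cbinom_0. unfold poch; simpl. field.
  - assert (Hd1 : ~ nonpos_int (d + 1)) by exact (not_nonpos_int_plus d 1 Hd).
    assert (Hd0 : d <> 0).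
    { assert (H := nonpos_int_neq_0 d 0 Hd). simpl in H. now rewrite Cplus_0_r in H. }
    (* Pascal's rule splits the sum into [b / d] times the sum at [(b + 1, d + 1)] and [-1] times
       the sum at [(b, d)]. Both keep [d - b], hence share the factor [(d - b)_N]. *)
    rewrite (csum_pascal (fun m => (-1) ^ m * (poch b (S N - m) / poch d (S N - m)))).
    rewrite (csum_ext _ (fun m => b / d * (cbinom N m * ((-1) ^ m
        * (poch (b + 1) (N - m) / poch (d + 1) (N - m)))))).
    2:{ intros k Hk. replace (S N - k)%nat with (S (N - k)) by lia.
        rewrite !poch_S_l. field. auto using poch_neq_0. }
    rewrite (csum_ext (fun r => cbinom N r * ((-1) ^ S r * _)) (fun m => (-1) * (cbinom N m * ((-1) ^ m
        * (poch b (N - m) / poch d (N - m)))))).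
    2:{ intros k Hk. replace (S N - S k)%nat with (N - k)%nat by lia.
        rewrite Cpow_S. ring. }
    rewrite !csum_scal, !IH by auto.
    replace (d + 1 - (b + 1)) with (d - b) by ring.
    assert (E := poch_shift d N).
    assert (Hp := poch_neq_0 _ N Hd). assert (Hp1 := poch_neq_0 _ N Hd1).
    assert (Hn := nonpos_int_neq_0 _ N Hd).
    replace (poch (d + 1) N) with (poch d N * (d + RtoC (INR N)) / d) by (rewrite <- E; now field).
    rewrite !poch_S, Cpow_S. field. auto.
Qed.

(** Both identities have [d - b = beta], so the factor [(d - b)_N] produced by Chu-Vandermonde
    cancels [(beta)_N]; the sign [(-1)^N] is that of the series at [-1]. *)
Lemma KdF_diagonal (al ga be b d : C) (N : nat) :
  ~ nonpos_int be -> ~ nonpos_int d -> d - b = be ->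
  rGamma d * csum (fun m => KdF_term al ga be b d (-1) 1 m (N - m)) (S N) = kterm al ga d N.
Proof.
  intros Hbe Hd E.
  rewrite (csum_ext _ (fun m => poch al N * poch ga N / (poch be N * RtoC (INR (fact N)))
     * (cbinom N m * ((-1) ^ m * (poch b (N - m) / poch d (N - m)))))).
  - rewrite csum_scal, chu_vandermonde, E by auto. unfold kterm.
    rewrite (rGamma_poch d N). field. auto using poch_neq_0, RtoC_fact_neq_0.
  - intros m Hm. unfold KdF_term, cbinom, Binomial.C.
    replace (m + (N - m))%nat with N by lia. rewrite Cpow_1_l.
    rewrite RtoC_div, RtoC_mult by (apply Rmult_integral_contrapositive; split; apply INR_fact_neq_0).
    field. repeat split; auto using poch_neq_0, RtoC_fact_neq_0.
Qed.

Lemma KdF_partial_kterm (al ga be b d : C) (K : nat) :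
  ~ nonpos_int be -> ~ nonpos_int d -> d - b = be ->
  rGamma d * KdF_partial al ga be b d (-1) 1 K = csum (kterm al ga d) (S K).
Proof.
  intros Hbe Hd E. unfold KdF_partial. rewrite <- csum_scal.
  apply csum_ext. intros N _. now apply KdF_diagonal.
Qed.

(** Here the convergence hypothesis is reduced to null terms, as differences of consecutive partial
    sums. *)
Lemma KdF_converges_kterm (al ga be b d : C) :
  ~ nonpos_int be -> ~ nonpos_int d -> d - b = be ->
  KdF_converges al ga be b d (-1) 1 -> Ccv (kterm al ga d) 0.
Proof.
  intros Hbe Hd E [L HL]. apply Ccv_filterlim in HL.
  assert (H : Ccv (csum (kterm al ga d)) (rGamma d * L)).
  { apply Ccv_incr. apply (Ccv_ext (fun K => rGamma d * KdF_partial al ga be b d (-1) 1 K)).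
    - intros K. now apply KdF_partial_kterm.
    - now apply Ccv_scal. }
  apply (Ccv_ext (fun n => csum (kterm al ga d) (S n) - csum (kterm al ga d) n)).
  - intros n. rewrite csum_S. ring.
  - apply (Ccv_eq _ (rGamma d * L - rGamma d * L)); [ | ring ].
    apply Ccv_minus; auto. now apply (proj1 (Ccv_incr _ _)) in H.
Qed.

Lemma KdF_converges_to_kterm (al ga be b d V : C) :
  ~ nonpos_int be -> ~ nonpos_int d -> d - b = be ->
  Ccv (csum (kterm al ga d)) V -> KdF_converges_to al ga be b d (-1) 1 (V / rGamma d).
Proof.
  intros Hbe Hd E HV. apply Ccv_filterlim.
  apply (Ccv_ext (fun K => csum (kterm al ga d) (S K) / rGamma d)).
  - intros K. rewrite <- (KdF_partial_kterm al ga be b d K) by auto.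
    field. now apply rGamma_neq_0.
  - apply Ccv_div; auto using rGamma_neq_0, Ccv_const. now apply (proj1 (Ccv_incr _ _)) in HV.
Qed.

Theorem theorem11 (i : nat) (alpha beta gamma : C) :
  (* first identity *)
  ( let ii := RtoC (INR i) in
    ~ nonpos_int beta ->
    ~ nonpos_int (alpha - gamma + 1 + ii) ->
    ~ nonpos_int (1 + alpha - gamma + ii) ->
    ~ nonpos_int (gamma - ii) ->
    ~ nonpos_int gamma ->
    ~ nonpos_int (1 + alpha - 2 * gamma + ii) ->
    (forall r : nat, (r <= i)%nat ->
       ~ nonpos_int ((alpha + ii + RtoC (INR r) + 1) / 2 - gamma) /\
       ~ nonpos_int ((alpha - ii + RtoC (INR r) + 1) / 2)) ->
    KdF_converges alpha gamma beta (alpha - beta - gamma + 1 + ii)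
                  (alpha - gamma + 1 + ii) (-1) 1 ->
    KdF_converges_to alpha gamma beta (alpha - beta - gamma + 1 + ii)
                     (alpha - gamma + 1 + ii) (-1) 1
      (cpow_pos 2 (ii - 2 * gamma) * CGamma (1 + alpha - gamma + ii)
         * CGamma (gamma - ii) / (CGamma gamma * CGamma (1 + alpha - 2 * gamma + ii))
       * csum (fun r => Cpow (-1) r * cbinom i r
                 * CGamma ((alpha + ii + RtoC (INR r) + 1) / 2 - gamma)
                 / CGamma ((alpha - ii + RtoC (INR r) + 1) / 2)) (S i)) )
  /\
  (* second identity *)
  ( let ii := RtoC (INR i) in
    ~ nonpos_int beta ->
    ~ nonpos_int (alpha - gamma + 1 - ii) ->
    ~ nonpos_int (1 + alpha - gamma - ii) ->
    ~ nonpos_int (1 + alpha - 2 * gamma - ii) ->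
    (forall r : nat, (r <= i)%nat ->
       ~ nonpos_int ((alpha - ii + RtoC (INR r) + 1) / 2 - gamma) /\
       ~ nonpos_int ((alpha - ii + RtoC (INR r) + 1) / 2)) ->
    KdF_converges alpha gamma beta (alpha - beta - gamma + 1 - ii)
                  (alpha - gamma + 1 - ii) (-1) 1 ->
    KdF_converges_to alpha gamma beta (alpha - beta - gamma + 1 - ii)
                     (alpha - gamma + 1 - ii) (-1) 1
      (cpow_pos 2 (- ii - 2 * gamma) * CGamma (1 + alpha - gamma - ii)
         / CGamma (1 + alpha - 2 * gamma - ii)
       * csum (fun r => cbinom i r
                 * CGamma ((alpha - ii + RtoC (INR r) + 1) / 2 - gamma)
                 / CGamma ((alpha - ii + RtoC (INR r) + 1) / 2)) (S i)) ).
Proof.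
  split; intros ii Hbe Hd.
  - intros Hd' Hg Hga H2 Hr Hcv.
    set (d := alpha - gamma + 1 + ii) in *.
    assert (Eb : d - (alpha - beta - gamma + 1 + ii) = beta) by (unfold d; ring).
    assert (Hu := KdF_converges_kterm _ _ _ _ _ Hbe Hd Eb Hcv).
    (* This choice makes [d = 1 + alpha - g] and [gamma = g + i], the shape of [kummer_plus]. *)
    set (g := gamma - ii) in *.
    assert (Ed : d = 1 + alpha - g) by (unfold d, g; ring).
    assert (Eg : g + RtoC (INR i) = gamma) by (unfold g, ii; ring).
    assert (Er : forall r, (alpha + ii + RtoC (INR r) + 1) / 2 - gamma
      = (alpha - RtoC (INR i) + RtoC (INR r) + 1) / 2 - g) by (intros r; unfold g, ii; field).
    assert (HK := kummer_plus i alpha g).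
    rewrite Eg, <- Ed in HK. assert (HK' := fun P => HK P Hu). clear HK.
    assert (HK := HK' ltac:(intros r Hr'; rewrite <- Er; now apply Hr)). clear HK'.
    assert (Hp := poch_neq_0 g i Hg).
    apply (Ccv_scal (/ poch g i)) in HK.
    apply (Ccv_ext _ (csum (kterm alpha gamma d))) in HK; [ | intros n; field; exact Hp ].
    apply (KdF_converges_to_kterm _ _ beta (alpha - beta - gamma + 1 + ii)) in HK; auto.
    revert HK. match goal with |- KdF_converges_to _ _ _ _ _ _ _ ?x -> KdF_converges_to _ _ _ _ _ _ _ ?y =>
      replace x with y; [ easy | ] end.
    rewrite (CGamma_rGamma (1 + alpha - gamma + ii)), (CGamma_rGamma g), (CGamma_rGamma gamma),
      (CGamma_rGamma (1 + alpha - 2 * gamma + ii)) by auto.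
    replace (1 + alpha - gamma + ii) with d by (unfold d; ring).
    rewrite (csum_ext _ (fun r => cbinom i r * ((-1) ^ r
       * (rGamma ((alpha - RtoC (INR i) + RtoC (INR r) + 1) / 2)
       / rGamma ((alpha - RtoC (INR i) + RtoC (INR r) + 1) / 2 - g))))).
    2:{ intros r Hr'. destruct (Hr r ltac:(lia)) as [Hr1 Hr2].
        rewrite !CGamma_rGamma by auto. rewrite Er in *. fold ii in Hr1 |- *.
        field. auto using rGamma_neq_0. }
    fold (gamma_sum (-1) i alpha g).
    (* This turns the division by [poch g i] into the prefactor
       [Gamma(gamma - i) / Gamma(gamma)]. *)
    assert (Egp := rGamma_poch g i). rewrite Eg in Egp.
    replace (1 + alpha - 2 * g - RtoC (INR i)) with (1 + alpha - 2 * gamma + ii) by (unfold g, ii; ring).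
    replace (- RtoC (INR i) - 2 * g) with (ii - 2 * gamma) by (unfold g, ii; ring).
    rewrite Egp. field. repeat split; auto using rGamma_neq_0.
  - intros Hd' H2 Hr Hcv.
    set (d := alpha - gamma + 1 - ii) in *.
    assert (Eb : d - (alpha - beta - gamma + 1 - ii) = beta) by (unfold d; ring).
    assert (Hu := KdF_converges_kterm _ _ _ _ _ Hbe Hd Eb Hcv).
    assert (Ed : d = 1 + alpha - gamma - RtoC (INR i)) by (unfold d, ii; ring).
    assert (HK := kummer_minus i alpha gamma (fun r Hr' => proj1 (Hr r Hr'))).
    rewrite <- Ed in HK. specialize (HK Hu).
    apply (KdF_converges_to_kterm _ _ beta (alpha - beta - gamma + 1 - ii)) in HK; auto.
    revert HK. match goal with |- KdF_converges_to _ _ _ _ _ _ _ ?x -> KdF_converges_to _ _ _ _ _ _ _ ?y =>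
      replace x with y; [ easy | ] end.
    rewrite (CGamma_rGamma (1 + alpha - gamma - ii)), (CGamma_rGamma (1 + alpha - 2 * gamma - ii)) by auto.
    replace (1 + alpha - gamma - ii) with d by (unfold d; ring).
    rewrite (csum_ext _ (fun r => cbinom i r * (1 ^ r
       * (rGamma ((alpha - RtoC (INR i) + RtoC (INR r) + 1) / 2)
       / rGamma ((alpha - RtoC (INR i) + RtoC (INR r) + 1) / 2 - gamma))))).
    2:{ intros r Hr'. destruct (Hr r ltac:(lia)) as [Hr1 Hr2].
        rewrite !CGamma_rGamma by auto. rewrite Cpow_1_l. fold ii.
        field. auto using rGamma_neq_0. }
    fold (gamma_sum 1 i alpha gamma). fold ii.
    field. auto using rGamma_neq_0.
Qed.
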